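(* Let $1<p<\infty$ and let $X=(X,d,\mu)$ be a metric measure space equipped with a doubling measure $\mu$ and supporting a $(1,p)$-Poincaré inequality; let $\tau\ge1$ be a dilatation constant with which both the $(1,p)$-Poincaré and the $(p,p)$-Poincaré inequality hold in $X$. Assume that $E\subset X$ is a uniformly $p$-fat closed set. Then there exists a constant $C>0$ such that the local $p$-Hardy inequality $$\int_{B\setminus E}\Bigl(\frac{|u|}{d_E}\Bigr)^p\,d\mu\le C\int_{32\tau^2B}g^p\,d\mu$$ holds whenever $u$ is a Lipschitz function in $X$ such that $u=0$ in $E$, $g$ is a $p$-weak upper gradient of $u$, and $B=B(w,r)$ is a ball with $w\in E$ and $0<r<(1/32)\operatorname{diam}(X)$.
   Context: Setting: $X=(X,d,\mu)$ is a metric space (not assumed to be complete) with metric $d$ and a positive complete Borel measure $\mu$ (extended as a Borel regular outer measure) such that $0<\mu(B(x,r))<\infty$ for all balls $B(x,r)=\{y\in X: d(y,x)<r\}$. For $B=B(x,r)$ and $t>0$, $tB=B(x,tr)$; $\overline{A}$ is the closure of $A$ (so $\overline{B}$ is the closure of the ball $B$). $\mu$ is doubling: there is a constant $C_D\ge 1$ with $\mu(2B)\le C_D\,\mu(B)$ for all balls $B$. Notation: $d_E(x)=\operatorname{dist}(x,E)$. Lipschitz functions: $\operatorname{Lip}(X)$ is the set of Lipschitz functions $u\colon X\to\mathbb{R}$, and for $A\subset X$, $\operatorname{Lip}_0(A)=\{u\in\operatorname{Lip}(X): u=0\text{ in }X\setminus A\}$. Weak upper gradients: a curve is a nonconstant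 rectifiable continuous map from a compact interval to $X$. A Borel function $g\ge 0$ on $X$ is an upper gradient of an extended real-valued function $u$ on $X$ if for all curves $\gamma$ joining arbitrary points $x,y\in X$ we have $|u(x)-u(y)|\le\int_\gamma g\,ds$ whenever $u(x),u(y)$ are both finite, and $\int_\gamma g\,ds=\infty$ otherwise. For $1\le p<\infty$, a measurable $g\ge0$ on $X$ is a $p$-weak upper gradient of $u$ if this holds for $p$-almost every curve, i.e. there is a non-negative Borel function $\rho\in L^p(X)$ with $\int_\gamma\rho\,ds=\infty$ for every curve $\gamma$ for which the condition fails. Poincaré inequality: $X$ supports a $(q,p)$-Poincaré inequality ($1\le q,p<\infty$) with constant $C>0$ and dilatation $\lambda\ge1$ if for all balls $B\subset X$, all measurable functions $u$ on $X$ and all $p$-weak upper gradients $g$ of $u$, $$\Bigl(\frac1{\mu(B)}\int_B|u-u_B|^q\,d\mu\Bigr)^{p/q}\le C\operatorname{diam}(B)^p\,\frac1{\mu(\lambda B)}\int_{\lambda B}g^p\,d\mu,$$ where $u_B=\frac1{\mu(B)}\int_B u\,d\mu$ and the left-hand side is interpreted as $\infty$ if $u_B$ is not defined. (It is known that, for $1<p<\infty$ and $\mu$ doubling, a $(1,p)$-Poincaré inequality implies a $(p,p)$-Poincaré inequality; the paper uses common constants $C_P>0$ and $\tau\ge1$ for both.) Capacity: for a bounded open $\Omega\subset X$ and a closed set $K\subset\Omega$, $\operatorname{cap}_p(K,\Omega)=\inf\int_\Omega g^p\,d\mu$, the infimum over all $u\in\operatorname{Lip}_0(\Omega)$ with $u\ge1$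 in $K$ and all $p$-weak upper gradients $g$ of $u$ ($=\infty$ if there are no such $u$). Uniform fatness: for $1\le p<\infty$, a closed set $E\subset X$ is uniformly $p$-fat if there is a constant $0<c_0\le1$ such that $\operatorname{cap}_p(E\cap\overline{B(x,r)},B(x,2r))\ge c_0\operatorname{cap}_p(\overline{B(x,r)},B(x,2r))$ for all $x\in E$ and all $0<r<(1/8)\operatorname{diam}(X)$. *)

(* Defs.v *)
From HB Require Import structures.
From mathcomp Require Import all_boot all_order all_algebra.
From mathcomp Require Import all_classical all_reals all_analysis.
From mathcomp Require Import measurable_realfun.

Set Implicit Arguments.
Unset Strict Implicit.
Unset Printing Implicit Defensive.

Import Order.TTheory GRing.Theory Num.Theory.
Import numFieldNormedType.Exports.

Local Open Scope classical_set_scope.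
Local Open Scope ring_scope.
Local Open Scope ereal_scope.

(* The sigma-algebra is not tied to the topology here: that it is the
   completion of the Borel one follows from [borel_regular_complete] below
   when balls have finite measure. *)
#[short(type="measurableMetricType")]
HB.structure Definition MeasurableMetric (d : measure_display)
  (R : numDomainType) := { T of Measurable d T & Metric R T }.

Section metric.
Context {R : realType} {X : metricType R}.

Definition diam (A : set X) : \bar R :=
  ereal_sup [set (mdist xy.1 xy.2)%:E | xy in A `*` A].

(* [lipschitz] in the library is restricted to normed modules. *)
Definition Lip (u : X -> R) : Prop :=
  exists L : R, forall x y, (`|u x - u y| <= L * mdist x y)%R.

Definition Lip0 (A : set X) (u : X -> R) : Prop :=
  Lip u /\ forall x, ~ A x -> u x = 0%R.

(* Metric-valued counterpart of [total_variation]. *)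
Definition curve_length (a b : R) (f : R -> X) : \bar R :=
  ereal_sup [set (\sum_(0 <= n < size s)
      mdist (f (nth b (a :: s) n)) (f (nth b (a :: s) n.+1)))%R%:E
    | s in [set s | itv_partition a b s]].

(* The values of [curve_fun] outside [curve_left, curve_right] are junk. *)
Record curve := Curve {
  curve_fun :> R -> X ;
  curve_left : R ;
  curve_right : R ;
  curve_continuous :
    {within `[curve_left, curve_right], continuous curve_fun} ;
  curve_rectifiable : curve_length curve_left curve_right curve_fun < +oo ;
  curve_nonconstant : exists s t : R,
    [/\ s \in `[curve_left, curve_right], t \in `[curve_left, curve_right]
      & curve_fun s <> curve_fun t] }.

Definition length (c : curve) : \bar R :=
  curve_length (curve_left c) (curve_right c) c.

(* Arc-length parametrization: the point of [c] reached after length [l],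
   for 0 <= l <= length c. As s |-> length (c restricted to [left, s]) is
   continuous and nondecreasing, the infimum is a minimum. *)
Definition arclength_param (c : curve) (l : R) : X :=
  c (inf [set s | s \in `[curve_left c, curve_right c] /\
                  curve_length (curve_left c) s c = l%:E]).

(* [lebesgue_measure] lives on Borel sets, but the library integral of a
   nonnegative function is the supremum over Borel simple functions below it,
   hence it is the usual integral for merely Lebesgue measurable integrands
   too. This matters for p-weak upper gradients, which need not be Borel: their
   composition with [arclength_param c] is Lebesgue measurable for p-almost
   every curve [c]. *)
Definition line_integral (c : curve) (g : X -> \bar R) : \bar R :=
  \int[lebesgue_measure]_(l in `[0%R, fine (length c)]) g (arclength_param c l).

Definition upper_gradient_along (u g : X -> \bar R) (c : curve) : Prop :=
  let x := c (curve_left c) in let y := c (curve_right c) in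
  if (u x \is a fin_num) && (u y \is a fin_num)
  then (`|u x - u y| <= line_integral c g : Prop)
  else line_integral c g = +oo.

End metric.
Arguments curve {R} X.

Section metric_measure.
Context {R : realType} {d : measure_display} {X : measurableMetricType d R}.
Variable mu : {measure set X -> \bar R}.
Implicit Types (p q : R) (u g : X -> \bar R).

Definition borel_set : set (set X) := <<s @open X >>.

Definition borel_fun (f : X -> \bar R) : Prop :=
  measurable_fun setT (f : g_sigma_algebraType (@open X) -> \bar R).

(* [mu^*] is the outer measure induced by [mu]. *)
Definition borel_regular_complete : Prop :=
  [/\ borel_set `<=` measurable, measure_is_complete mu
    & forall A : set X, exists B : set X,
        [/\ borel_set B, A `<=` B & mu B = (mu^*)%mu A] ].

Definition finite_positive_on_balls : Prop :=
  forall (x : X) (r : R), (0 < r)%R -> 0 < mu (ball x r) < +oo.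

Definition doubling : Prop :=
  exists CD : R, (1 <= CD)%R /\
    forall (x : X) (r : R), (0 < r)%R ->
      mu (ball x (2 * r)%R) <= CD%:E * mu (ball x r).

Definition weak_upper_gradient p u g : Prop :=
  [/\ measurable_fun setT g, (forall x, 0 <= g x)
    & exists rho : X -> \bar R,
        [/\ borel_fun rho, (forall x, 0 <= rho x),
            \int[mu]_x (rho x `^ p) < +oo
          & forall c : curve X,
              ~ upper_gradient_along u g c -> line_integral c rho = +oo] ].

Definition average (A : set X) (f : X -> \bar R) : \bar R :=
  (mu A)^-1 * \int[mu]_(x in A) f x.

Definition average_defined (A : set X) (f : X -> \bar R) : Prop :=
  \int[mu]_(x in A) f^\+ x < +oo \/ \int[mu]_(x in A) f^\- x < +oo.

(* If u_B is infinite then [u x - average B u] is infinite for every x (in the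
   library +oo - +oo and -oo + +oo are -oo), so the oscillation is +oo. *)
Definition mean_oscillation q (B : set X) u : \bar R :=
  if `[< average_defined B u >]
  then average B (fun x => `|u x - average B u| `^ q)
  else +oo.

Definition poincare q p (lambda : R) : Prop :=
  exists C : R, (0 < C)%R /\
    forall (x : X) (r : R), (0 < r)%R ->
    forall u g, measurable_fun setT u -> weak_upper_gradient p u g ->
      mean_oscillation q (ball x r) u `^ (p / q)
      <= C%:E * diam (ball x r) `^ p
         * average (ball x (lambda * r)%R) (fun y => g y `^ p).

(* Meaningful for Omega bounded and open and K closed, K `<=` Omega. *)
Definition capacity p (K Omega : set X) : \bar R :=
  ereal_inf [set v | exists (u : X -> R) (g : X -> \bar R),
    [/\ Lip0 Omega u, (forall x, K x -> (1 <= u x)%R),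
        weak_upper_gradient p (EFin \o u) g
      & v = \int[mu]_(x in Omega) (g x `^ p)] ].

Definition uniformly_fat p (E : set X) : Prop :=
  exists c0 : R, (0 < c0 <= 1)%R /\
    forall (x : X) (r : R), E x -> (0 < r)%R ->
      r%:E < (8^-1)%:E * diam [set: X] ->
      c0%:E * capacity p (closure (ball x r)) (ball x (2 * r)%R)
      <= capacity p (E `&` closure (ball x r)) (ball x (2 * r)%R).

End metric_measure.

(* Main.v *)
Require Import Defs.
From mathcomp Require Import all_boot all_order all_algebra.
From mathcomp Require Import all_classical all_reals all_analysis.
From mathcomp Require Import measurable_realfun.
From mathcomp Require Import ring lra.

Set Implicit Arguments.
Unset Strict Implicit.
Unset Printing Implicit Defensive.
Import Order.TTheory GRing.Theory Num.Theory.
Import numFieldNormedType.Exports.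

Local Open Scope classical_set_scope.
Local Open Scope ring_scope.
Local Open Scope ereal_scope.

(** Fatness says that, near each of its points, [E] is as large for the
p-capacity as a ball. Let [u] vanish on [E], let [x] be in [E], and let [m] be a
constant from which |u| has small mean deviation on the ball B(x, 2 rho), by the
Poincare inequality. A cutoff function times (1 - |u| / m)_+ is admissible for
the capacity of the part of [E] in the closed ball of radius [rho], so fatness
and the lower bound [capacity_ball_ge] for the capacity of balls control [m].
This gives the Poincare inequality at the boundary ([boundary_poincare]):

  int_(B(x, 2 rho)) |u|^p <= C rho^p int_(B(x, 2 tau rho)) g^p.

Let d be the distance to [E]. Boundedly overlapping balls centred in [E] cover
the points where d < t, and adding up their inequalities yields
([strip_estimate])

  int_(d < t) |v|^p <= C t^p int_(d < 2 tau t) g^p.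

Multiplied by t^-p and summed over t = T / 2^k, this just fails: each scale
contributes the same amount on the right. Multiplied by t^-(p + b) with b > 0,
the scales that see a given point form a geometric series ([weighted_hardy]):

  int |V|^p d^-(p + b) <= (C / b) int d^-b G^p

for functions V that vanish on [E] and off a ball of radius T centred in [E],
with upper gradient G. Wannebo's idea is to
use this for V = v d^(b / p). By the Leibniz rule one may take
G = C d^(b / p) (g + (b / p) |v| / d), hence

  int |v|^p d^-p <= (C / b) int g^p + C b^(p - 1) int |v|^p d^-p.

As p > 1, the last term is absorbed on the left once b is small, provided that
it is finite. To this end d is first replaced by its truncation at T / 2^K from
below ([truncated_hardy]); the constants do not depend on K, which then tends to
infinity ([hardy_supported]). Finally [local_hardy] cuts a general [u] off
outside 2B and bounds the term |u| / r that this adds to the upper gradient by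
the Poincare inequality at the boundary.

All functions involved are Lipschitz, and a p-weak upper gradient may be
replaced by a Borel function that satisfies the upper gradient inequality along
every curve, at the cost of a constant factor and an arbitrarily small error in
the integral of its p-th power ([weak_upper_gradient_strong]). For such functions the two rules of calculus
that are used, [upper_gradientM] and [upper_gradient_restrict], follow by
cutting a curve into short pieces, or at the zeros of the function, without
differentiating along curves. *)

(** * Length of curves *)
Section curve_length.
Context {R : realType} {X : metricType R}.
Implicit Types (f : R -> X) (a b c : R).

(** Recursive form of the sums in [curve_length], for induction on the partition. *)
Fixpoint polygon_length f a (s : seq R) : R :=
  if s is x :: s' then (mdist (f a) (f x) + polygon_length f x s')%R else 0%R.

Lemma polygon_length_ge0 f a s : (0 <= polygon_length f a s)%R.
Proof. by elim: s a => //= x s ih a; rewrite addr_ge0 ?mdist_ge0. Qed.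

Lemma polygon_length_cat f a s t :
  polygon_length f a (s ++ t) =
  (polygon_length f a s + polygon_length f (last a s) t)%R.
Proof. by elim: s a => [|x s ih] a /=; rewrite ?add0r// ih addrA. Qed.

Lemma curve_lengthE a b f : curve_length a b f =
  ereal_sup [set (polygon_length f a s)%:E | s in itv_partition a b].
Proof.
rewrite /curve_length; congr ereal_sup; apply: eq_imagel => s _; congr EFin.
elim: s a => [|x s ih] a; first by rewrite big_geq.
by rewrite big_nat_recl//= -ih.
Qed.

Lemma curve_length_ub a b f s : itv_partition a b s ->
  (polygon_length f a s)%:E <= curve_length a b f.
Proof. by move=> abs; rewrite curve_lengthE; apply: ereal_sup_ubound; exists s. Qed.

Lemma curve_lengthxx a f : curve_length a a f = 0.
Proof.
rewrite curve_lengthE (_ : [set _ | _ in _] = [set 0]) ?ereal_sup1//.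
apply/seteqP; split => [_ [s /itv_partitionxx -> <-]//|_ ->].
by exists [::].
Qed.

Lemma mdist_le_curve_length a b f : (a <= b)%R ->
  (mdist (f a) (f b))%:E <= curve_length a b f.
Proof.
rewrite le_eqVlt => /predU1P[->|ab]; first by rewrite mdistxx curve_lengthxx.
by have := curve_length_ub f (itv_partition1 ab); rewrite /= addr0.
Qed.

Lemma curve_length_ge0 a b f : (a <= b)%R -> 0 <= curve_length a b f.
Proof.
move=> ab; apply: le_trans (mdist_le_curve_length f ab).
by rewrite lee_fin mdist_ge0.
Qed.

Lemma curve_length_cons a x b f : (a < x)%R -> 
  (mdist (f a) (f x))%:E + curve_length x b f <= curve_length a b f.
Proof.
move=> ax; rewrite -leeBrDl// [leLHS]curve_lengthE; apply: ge_ereal_sup.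
move=> _ [s [xs /eqP sb] <-]; rewrite leeBrDl// -EFinD.
by apply: (@curve_length_ub _ _ _ (x :: s)); split; rewrite /= ?ax ?sb.
Qed.

(** Adding [c] to a partition does not shorten the inscribed polygon, by the
    triangle inequality. *)
Lemma curve_lengthD a c b f : (a <= c)%R -> (c <= b)%R ->
  curve_length a b f < +oo ->
  curve_length a b f = curve_length a c f + curve_length c b f.
Proof.
move=> ac cb fin; apply/eqP; rewrite eq_le; apply/andP; split.
  rewrite curve_lengthE; apply: ge_ereal_sup => _ [s [+ /eqP sb] <-].
  elim: s a ac sb {fin} => [|x s ih] a ac /= sb.
    by rewrite adde_ge0// curve_length_ge0.
  move=> /andP[ax xs]; have [xc|cx] := leP x c.
    rewrite EFinD (le_trans _ (leeD2r _ (curve_length_cons c f ax)))//.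
    by rewrite -addeA leeD2l// ih.
  apply: (@le_trans _ _ ((mdist (f a) (f c))%:E +
      (mdist (f c) (f x) + polygon_length f x s)%:E)).
    by rewrite -EFinD lee_fin addrA lerD2r metric_triangle.
  rewrite leeD ?mdist_le_curve_length//.
  by apply: (@curve_length_ub _ _ _ (x :: s)); split; rewrite /= ?cx ?sb.
have cbfin s : itv_partition a c s ->
    (polygon_length f a s)%:E + curve_length c b f <= curve_length a b f.
  move=> [acs /eqP sc]; rewrite -leeBrDl// [leLHS]curve_lengthE.
  apply: ge_ereal_sup => _ [t [ct /eqP tb] <-]; rewrite leeBrDl// -EFinD.
  rewrite -[in X in (_ + X)%R]sc -polygon_length_cat; apply: curve_length_ub; split.
    by rewrite cat_path acs sc.
  by rewrite last_cat sc tb.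
have cfin : curve_length c b f \is a fin_num.
  rewrite ge0_fin_numE ?curve_length_ge0//; move: ac.
  rewrite le_eqVlt => /predU1P[<-//|ac].
  apply: le_lt_trans fin; apply: le_trans (cbfin _ (itv_partition1 ac)).
  by rewrite leeDr// lee_fin polygon_length_ge0.
rewrite -leeBrDr// [leLHS]curve_lengthE; apply: ge_ereal_sup => _ [s acs <-].
by rewrite leeBrDr// cbfin.
Qed.

Section rectifiable.
Variables (a b : R) (f : R -> X).
Hypothesis ffin : curve_length a b f < +oo.

Lemma curve_length_fin s t : (a <= s)%R -> (s <= t)%R -> (t <= b)%R ->
  curve_length s t f \is a fin_num.
Proof.
move=> as_ st tb; rewrite ge0_fin_numE ?curve_length_ge0//.
have atf : curve_length a t f < +oo.
  apply: le_lt_trans ffin.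
  by rewrite (curve_lengthD (le_trans as_ st) tb ffin) leeDl ?curve_length_ge0.
apply: le_lt_trans (atf).
by rewrite (curve_lengthD as_ st atf) leeDr// curve_length_ge0.
Qed.

Definition arc_length s := fine (curve_length a s f).

Lemma arc_lengthE s : (a <= s)%R -> (s <= b)%R ->
  (arc_length s)%:E = curve_length a s f.
Proof. by move=> as_ sb; rewrite /arc_length fineK// curve_length_fin. Qed.

Lemma arc_lengthB s t : (a <= s)%R -> (s <= t)%R -> (t <= b)%R ->
  (arc_length t - arc_length s)%:E = curve_length s t f.
Proof.
move=> as_ st tb; rewrite EFinB !arc_lengthE// ?(le_trans st)// ?(le_trans as_)//.
have fin : curve_length a t f < +oo.
  by rewrite -ge0_fin_numE ?curve_length_fin ?curve_length_ge0// (le_trans as_).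
rewrite (curve_lengthD as_ st fin) addeAC subee ?add0e// curve_length_fin//.
by rewrite (le_trans st).
Qed.

Lemma arc_length_nd s t : (a <= s)%R -> (s <= t)%R -> (t <= b)%R ->
  (arc_length s <= arc_length t)%R.
Proof.
move=> as_ st tb; rewrite -subr_ge0 -lee_fin arc_lengthB//.
exact: curve_length_ge0.
Qed.

Hypothesis fcont : {within `[a, b], continuous f}.

Let fdelta s (e : R) : (a <= s <= b)%R -> (0 < e)%R -> exists2 d : R, (0 < d)%R &
  forall t, (a <= t <= b)%R -> (`|s - t| < d)%R -> (mdist (f s) (f t) < e)%R.
Proof.
move=> sab e0; move: fcont => /subspace_continuousP/(_ s).
rewrite /= in_itv/= => /(_ sab) /cvg_ball - /(_ _ e0).
rewrite near_withinE => /nbhs_ballP[d /= d0 dP]; exists d => // t tab st.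
by have := dP t st; rewrite /= in_itv/= ballEmdist => /(_ tab).
Qed.

(** Take a polygon inscribed in [f] on [s, b] whose length is almost maximal, and
    let its first vertex after [s] slide towards [s]. The remaining arc carries
    almost all the length, so that little is left near [s]. *)
Let arc_length_right s (e : R) : (a <= s)%R -> (s < b)%R -> (0 < e)%R ->
  exists2 d : R, (0 < d)%R & forall t, (s <= t <= b)%R -> (t - s < d)%R ->
  (arc_length t - arc_length s < e)%R.
Proof.
move=> as_ sb e0; have e20 : (0 < e / 2)%R by rewrite divr_gt0.
have sbfin := curve_length_fin as_ (ltW sb) (lexx b).
have := sbfin; rewrite curve_lengthE.
move=> /(ub_ereal_sup_adherent e20)[_ [[|x p] [/= + /eqP pb] <-]].
  by move: pb sb => /= ->; rewrite ltxx.
move=> /andP[sx xp]; rewrite -curve_lengthE.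
have sab : (a <= s <= b)%R by rewrite as_ ltW.
have [d d0 dP] := fdelta sab e20.
move=> H; exists (Num.min d (x - s))%R; first by rewrite lt_min d0 subr_gt0.
move=> t /andP[st tb]; rewrite lt_min => /andP[td tx].
have tx' : (t < x)%R by move: tx; rewrite ltrD2r.
rewrite -lte_fin (@arc_lengthB s t)//.
have tbfin := curve_length_fin (le_trans as_ st) tb (lexx b).
rewrite -(lteD2rE _ _ tbfin).
have -> : curve_length s t f + curve_length t b f = curve_length s b f.
  rewrite -curve_lengthD// -ge0_fin_numE//; exact/curve_length_ge0/ltW.
move: H; rewrite EFinN lteBlDr// => /lt_le_trans; apply.
rewrite addeC [e%:E](_ : _ = (e / 2)%:E + (e / 2)%:E); last first.
  by rewrite -EFinD -splitr.
rewrite -addeA leeD2l//.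
apply: (@le_trans _ _ ((mdist (f s) (f t))%:E +
    (mdist (f t) (f x) + polygon_length f x p)%:E)).
  by rewrite -EFinD lee_fin addrA lerD2r metric_triangle.
rewrite leeD//.
  rewrite lee_fin; apply/ltW/dP; first by rewrite (le_trans as_).
  by rewrite distrC ger0_norm// subr_ge0.
by apply: (@curve_length_ub _ _ _ (x :: p)); split; rewrite /= ?tx'// pb.
Qed.

Let arc_length_left s (e : R) : (a < s)%R -> (s <= b)%R -> (0 < e)%R ->
  exists2 d : R, (0 < d)%R & forall t, (a <= t <= s)%R -> (s - t < d)%R ->
  (arc_length s - arc_length t < e)%R.
Proof.
move=> as_ sb e0; have e20 : (0 < e / 2)%R by rewrite divr_gt0.
have asfin := curve_length_fin (lexx a) (ltW as_) sb.
have := asfin; rewrite curve_lengthE.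
move=> /(ub_ereal_sup_adherent e20)[_ [p [+ /eqP ps] <-]]; rewrite -curve_lengthE.
have sab : (a <= s <= b)%R by rewrite sb ltW.
have [d d0 dP] := fdelta sab e20.
case/lastP: p ps => [/= as'|p x]; first by move: as_; rewrite as' ltxx.
rewrite last_rcons => ->; rewrite rcons_path => /andP[ap ls].
rewrite -cats1 polygon_length_cat/= addr0.
set z := last a p in ls *.
move=> H; exists (Num.min d (s - z))%R; first by rewrite lt_min d0 subr_gt0.
move=> t /andP[at_ ts]; rewrite lt_min => /andP[td tx].
have zt : (z < t)%R by move: tx; rewrite ltrD2l ltrN2.
rewrite -lte_fin EFinB !arc_lengthE//; last 2 first.
  exact: le_trans sb.
  exact: ltW.
rewrite lteBlDr ?curve_length_fin//; last exact: le_trans sb.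
move: H; rewrite EFinN lteBlDr// => /lt_le_trans; apply.
rewrite addeC [e%:E](_ : _ = (e / 2)%:E + (e / 2)%:E); last first.
  by rewrite -EFinD -splitr.
rewrite -addeA leeD2l//.
apply: (@le_trans _ _ ((mdist (f s) (f t))%:E +
    (polygon_length f a (rcons p t))%:E)).
  rewrite -cats1 polygon_length_cat/= addr0 -EFinD lee_fin -/z addrCA lerD2l.
  by rewrite addrC (metric_sym (f s)) metric_triangle.
rewrite leeD//.
  rewrite lee_fin; apply/ltW/dP; first by rewrite at_ (le_trans ts).
  by rewrite ger0_norm// subr_ge0.
by apply: curve_length_ub; split; rewrite ?last_rcons// rcons_path ap.
Qed.

Lemma arc_length_continuous : {within `[a, b], continuous arc_length}.
Proof.
apply/subspace_continuousP => s; rewrite /= in_itv/= => /andP[as_ sb].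
apply/cvgrPdist_lt => e e0; rewrite near_withinE.
have [d1 d10 d1P] : exists2 d : R, (0 < d)%R &
    forall t, (s <= t <= b)%R -> (t - s < d)%R ->
    (arc_length t - arc_length s < e)%R.
  move: sb; rewrite le_eqVlt => /predU1P[->|sb]; last exact: arc_length_right.
  by exists 1%R => // t; rewrite -eq_le => /eqP->; rewrite subrr.
have [d2 d20 d2P] : exists2 d : R, (0 < d)%R &
    forall t, (a <= t <= s)%R -> (s - t < d)%R ->
    (arc_length s - arc_length t < e)%R.
  move: as_; rewrite le_eqVlt => /predU1P[->|as_]; last exact: arc_length_left.
  by exists 1%R => // t; rewrite -eq_le => /eqP->; rewrite subrr.
apply/nbhs_ballP; exists (Num.min d1 d2); first by rewrite /= lt_min d10.
move=> t; rewrite /= /ball/= lt_min => /andP[td1 td2]; rewrite in_itv/= => /andP[at_ tb].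
have [st|/ltW ts] := leP s t.
  rewrite distrC ger0_norm ?subr_ge0 ?arc_length_nd// d1P ?st//.
  by rewrite -[ltLHS]ger0_norm ?subr_ge0// distrC.
rewrite ger0_norm ?subr_ge0 ?arc_length_nd// d2P ?at_//.
by rewrite -[ltLHS]ger0_norm ?subr_ge0.
Qed.

Lemma arc_length_surj (l : R) : (a <= b)%R -> (0 <= l <= arc_length b)%R ->
  exists2 s, (a <= s <= b)%R & arc_length s = l.
Proof.
move=> ab lab; have [|s] := IVT ab arc_length_continuous (v := l).
  have a0 : arc_length a = 0%R by rewrite /arc_length curve_lengthxx.
  by rewrite a0 min_l ?max_r//; case/andP: lab => /le_trans; apply.
by rewrite in_itv/=; exists s.
Qed.

(** The infimum in [arclength_param], with free endpoints so that it can be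
    compared for a curve and its subcurves. *)
Definition arc_time (l : R) : R :=
  inf [set s | s \in `[a, b] /\ curve_length a s f = l%:E].

(** The infimum is attained, since the arc length is continuous. *)
Lemma arc_timeP (l : R) : (a <= b)%R -> (0 <= l <= arc_length b)%R ->
  [/\ (a <= arc_time l <= b)%R, arc_length (arc_time l) = l
    & forall s, (a <= s <= b)%R -> arc_length s = l -> (arc_time l <= s)%R].
Proof.
move=> ab lab; set S := [set s | s \in `[a, b] /\ curve_length a s f = l%:E].
have SE s : S s <-> (a <= s <= b)%R /\ arc_length s = l.
  rewrite /S/= in_itv/=; split => -[sab sl]; split => //.
    by rewrite /arc_length sl.
  by case/andP: sab => ? ?; rewrite -arc_lengthE// sl.
have [s sab sl] := arc_length_surj ab lab.
have S0 : S !=set0 by exists s; apply/SE.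
have lbS : has_lbound S by exists a => t /SE[/andP[]].
have infS t : S t -> (inf S <= t)%R by move=> St; exact: ge_inf.
have Tab : (a <= inf S <= b)%R.
  rewrite (le_trans (infS s _)) ?andbT; [|by apply/SE|by case/andP: sab].
  by apply: lb_le_inf => // t /SE[/andP[]].
split => //; last by move=> t tab tl; apply: infS; apply/SE.
apply/eqP; rewrite -subr_eq0 -normr_eq0 eq_le normr_ge0 andbT; apply/ler_addgt0Pr => e e0.
rewrite add0r; have /subspace_continuousP/(_ (inf S)) := arc_length_continuous.
rewrite /= in_itv/= => /(_ Tab) /cvgrPdist_lt/(_ _ e0).
rewrite near_withinE => /nbhs_ballP[d /= d0 dP].
have [|t St tT] := inf_adherent d0 (E := S); first by split.
have [tab tl] := (SE t).1 St.
rewrite -[X in (_ - X)%R]tl; have := dP t; rewrite /= in_itv/= /ball/= => H.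
apply/ltW/H => //.
by rewrite distrC ger0_norm ?subr_ge0 ?infS// ltrBlDl.
Qed.

End rectifiable.
End curve_length.

(** * Truncation of real numbers *)

Section clamp.
Context {R : realType}.
Implicit Types a b s t : R.

Definition clamp a b t : R := Num.max a (Num.min b t).

Lemma clamp_itv a b t : (a <= b)%R -> (a <= clamp a b t <= b)%R.
Proof. by move=> ab; rewrite /clamp le_max lexx/= ge_max ab ge_min lexx. Qed.

Lemma clamp_id a b t : (a <= t <= b)%R -> clamp a b t = t.
Proof. by move=> /andP[ta tb]; rewrite /clamp min_r// max_r. Qed.

Lemma clamp_lip a b s t : (`|clamp a b s - clamp a b t| <= `|s - t|)%R.
Proof.
have max_lip x y : (`|Num.max a x - Num.max a y| <= `|x - y|)%R.
  wlog xy : x y / (x <= y)%R.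
    move=> H; have [|/ltW yx] := leP x y; first exact: H.
    by rewrite distrC (distrC x) H.
  rewrite ler_distlC (ler0_norm (_ : x - y <= 0)%R) ?subr_le0// opprB.
  by rewrite !maxEle; case: (leP a x) => ?; case: (leP a y) => ?; apply/andP; split; lra.
have min_lip x y : (`|Num.min b x - Num.min b y| <= `|x - y|)%R.
  wlog xy : x y / (x <= y)%R.
    move=> H; have [|/ltW yx] := leP x y; first exact: H.
    by rewrite distrC (distrC x) H.
  rewrite ler_distlC (ler0_norm (_ : x - y <= 0)%R) ?subr_le0// opprB.
  by rewrite !minEle; case: (leP b x) => ?; case: (leP b y) => ?; apply/andP; split; lra.
exact: le_trans (max_lip _ _) (min_lip _ _).
Qed.

End clamp.

(** * Arc length parametrization and subcurves *)
Section shift.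
Context {R : realType}.

Lemma lebesgue_measure_shift (s : R) (A : set R) : measurable A ->
  lebesgue_measure A = lebesgue_measure [set x | A (s + x)%R].
Proof.
move=> mA.
pose f (x : measurableTypeR R) : measurableTypeR R := (s + x)%R.
have ms : measurable_fun setT f by exact: measurable_funD.
apply: (@lebesgue_measure_unique R
  (measure_function_pushforward__canonical__measure_function_Measure
     (@lebesgue_measure R) ms)) => //.
move=> _ [[a b] _ <-] /=; rewrite /pushforward.
rewrite (_ : f @^-1` _ = `](a - s)%R, (b - s)%R]%classic); last first.
  by apply/seteqP; split => x /=; rewrite !in_itv/= ltrBlDl lerBrDl.
rewrite !lebesgue_measure_itv/= !lte_fin ltrD2r; case: ifP => // _.
by rewrite -!EFinD; congr EFin; ring.
Qed.

(** Translation invariance, which relates integrals along a subcurve to integrals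
    along the curve. *)
Lemma ge0_integral_shift (s : R) (D : set R) (f : R -> \bar R) :
  measurable D -> measurable_fun D f -> {in D, forall y, 0 <= f y} ->
  \int[lebesgue_measure]_(x in [set x | D (s + x)%R]) f (s + x)%R =
  \int[lebesgue_measure]_(y in D) f y.
Proof.
move=> mD mf f0.
pose h (x : measurableTypeR R) : measurableTypeR R := (s + x)%R.
have ms : measurable_fun setT h by exact: measurable_funD.
rewrite -[LHS](ge0_integral_pushforward ms (@lebesgue_measure R) mD mf f0).
by apply: eq_measure_integral => A mA _; symmetry; exact: lebesgue_measure_shift.
Qed.

End shift.

Section curves.
Context {R : realType} {d : measure_display} {X : measurableMetricType d R}.
Variable c : curve X.
Local Notation a := (curve_left c).
Local Notation b := (curve_right c).
Local Notation L := (fine (length c)).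
Local Notation gamma := (arclength_param c).

Lemma curve_left_le_right : (a <= b)%R.
Proof.
have [s [t []]] := curve_nonconstant c; rewrite in_itv/= => /andP[/le_trans + /[swap] _].
by move=> /[apply].
Qed.
Local Notation ab := curve_left_le_right.
Local Notation cfin := (curve_rectifiable c).
Local Notation ccont := (@curve_continuous _ _ c).

Lemma length_ge0 : (0 <= L)%R.
Proof. by apply: fine_ge0; exact: curve_length_ge0 ab. Qed.

Let sigma := arc_time a b c.

Let sigmaP l : (0 <= l <= L)%R ->
  [/\ (a <= sigma l <= b)%R, arc_length a c (sigma l) = l
    & forall s, (a <= s <= b)%R -> arc_length a c s = l -> (sigma l <= s)%R].
Proof. by move=> lL; apply: arc_timeP => //; [exact: cfin|exact: ccont|exact: ab]. Qed.

Let sigma_nd l m : (0 <= l)%R -> (l <= m)%R -> (m <= L)%R -> (sigma l <= sigma m)%R.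
Proof.
move=> l0 lm mL; have [|/andP[la lb] ll lmin] := @sigmaP l.
  by rewrite l0 (le_trans lm).
have [|/andP[ma mb] mm _] := @sigmaP m; first by rewrite mL (le_trans l0).
rewrite leNgt; apply/negP => ml; suff ? : l = m.
  by move: ml; rewrite ltNge lmin// ?ma// mm.
apply/le_anti; rewrite lm -{1}mm -ll/=; apply: arc_length_nd (lb) => //.
  exact: cfin.
exact: ltW.
Qed.

Let sigma_length l m : (0 <= l)%R -> (l <= m)%R -> (m <= L)%R ->
  curve_length (sigma l) (sigma m) c = (m - l)%:E.
Proof.
move=> l0 lm mL; have [|/andP[la lb] ll lmin] := @sigmaP l.
  by rewrite l0 (le_trans lm).
have [|/andP[ma mb] mm _] := @sigmaP m; first by rewrite mL (le_trans l0).
rewrite -(arc_lengthB cfin)//; first by rewrite ll mm.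
exact: sigma_nd.
Qed.

Lemma arclength_param_lip l m : (0 <= l)%R -> (l <= m)%R -> (m <= L)%R ->
  (mdist (gamma l) (gamma m) <= m - l)%R.
Proof.
move=> l0 lm mL; rewrite -lee_fin -sigma_length//.
by apply: mdist_le_curve_length; exact: sigma_nd.
Qed.

Lemma arclength_param_left : gamma 0%R = c a.
Proof.
have [|/andP[la lb] ll lmin] := @sigmaP 0%R; first by rewrite lexx length_ge0.
congr (curve_fun c _); apply/le_anti; rewrite la andbT.
by apply: lmin; rewrite ?lexx ?ab// /arc_length curve_lengthxx.
Qed.

Lemma arclength_param_right : gamma L = c b.
Proof.
have [|/andP[la lb] ll lmin] := @sigmaP L; first by rewrite lexx length_ge0.
apply: mdist_positivity; apply: le_anti; rewrite mdist_ge0 andbT -lee_fin.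
apply: le_trans (mdist_le_curve_length c lb) _.
by rewrite -(arc_lengthB cfin)// ll /arc_length subrr.
Qed.

Lemma curve_length_constant f (s t : R) :
  (forall u v, (s <= u <= t)%R -> (s <= v <= t)%R -> f u = f v :> X) ->
  curve_length s t f <= 0.
Proof.
move=> fE; rewrite curve_lengthE; apply: ge_ereal_sup => _ [p + <-].
elim: p s fE => [//|x p ih] s fE [/= /andP[sx xp] /eqP pt].
have xt : (x <= t)%R by apply: (@itv_partition_le _ _ x t p); split; rewrite ?pt.
rewrite (fE s x) ?lexx ?(ltW sx)//; last by rewrite (le_trans (ltW sx)).
rewrite mdistxx add0r; apply: ih; last by split => //; rewrite pt.
move=> u v /andP[xu ut] /andP[xv vt]; apply: fE.
  by rewrite ut (le_trans (ltW sx)).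
by rewrite vt (le_trans (ltW sx)).
Qed.

Let subcurve_param l m k : (0 <= l)%R -> (m <= L)%R -> (0 <= k <= m - l)%R ->
  arc_time (sigma l) (sigma m) c k = sigma (l + k).
Proof.
move=> l0 mL /andP[k0 kml].
have lm : (l <= m)%R by rewrite -subr_ge0 (le_trans k0).
have lkm : (l + k <= m)%R by rewrite -lerBrDl.
have lk0 : (0 <= l + k)%R by rewrite addr_ge0.
have llk : (l <= l + k)%R by rewrite lerDl.
have lL := le_trans lm mL; have lkL := le_trans lkm mL.
have s1 := sigma_nd l0 llk lkL; have s2 := sigma_nd lk0 lkm mL.
have [|/andP[la lb] ll _] := @sigmaP l; first by rewrite l0.
have [|/andP[ma mb] mm _] := @sigmaP m; first by rewrite mL (le_trans l0).
have [|/andP[ka kb] kk kmin] := @sigmaP (l + k)%R; first by rewrite lk0.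
rewrite /arc_time; set S := [set s | _].
have Sk : S (sigma (l + k)%R).
  by rewrite /S/= in_itv/= s1 s2; split => //; rewrite sigma_length// addrC addKr.
have lbS : lbound S (sigma (l + k)).
  move=> s [+ sk]; rewrite in_itv/= => /andP[ls sm]; apply: kmin.
    by rewrite (le_trans la)// (le_trans sm).
  have sb : (s <= b)%R by exact: le_trans mb.
  have : (arc_length a c s - arc_length a c (sigma l))%:E = k%:E.
    by rewrite (arc_lengthB cfin).
  by rewrite ll => -[/eqP]; rewrite subr_eq addrC => /eqP.
apply/le_anti/andP; split; last by apply: lb_le_inf => //; exists (sigma (l + k)).
by apply: ge_inf => //; exists (sigma (l + k)).
Qed.

(** Restrict [c] to the parameters between the first times at which the arc length
    is [l] and [m]; this restriction is not constant because its length is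
    positive. *)
Lemma subcurve l m : (0 <= l)%R -> (l < m)%R -> (m <= L)%R ->
  exists c' : curve X, [/\ c' (curve_left c') = gamma l,
    c' (curve_right c') = gamma m, fine (length c') = (m - l)%R &
    forall k, (0 <= k <= m - l)%R -> arclength_param c' k = gamma (l + k)].
Proof.
move=> l0 lm mL; have lL := le_trans (ltW lm) mL.
have [|/andP[la lb] ll _] := @sigmaP l; first by rewrite l0.
have [|/andP[ma mb] mm _] := @sigmaP m; first by rewrite mL (le_trans l0)// ltW.
have sl := sigma_length l0 (ltW lm) mL.
have c'cont : {within `[sigma l, sigma m], continuous c}.
  apply: continuous_subspaceW ccont => x /=; rewrite !in_itv/= => /andP[lx xm].
  by rewrite (le_trans la)// (le_trans xm).
have c'fin : curve_length (sigma l) (sigma m) c < +oo by rewrite sl ltry.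
have c'nc : exists s t : R, [/\ s \in `[sigma l, sigma m],
    t \in `[sigma l, sigma m] & c s <> c t].
  apply: contrapT => H; suff : curve_length (sigma l) (sigma m) c <= 0.
    by rewrite sl lee_fin leNgt subr_gt0 lm.
  apply: curve_length_constant => u v lu lv; apply: contrapT => uv.
  by apply: H; exists u, v; rewrite !in_itv/=.
exists (Curve c'cont c'fin c'nc); split => //.
  by rewrite /length/= sl.
move=> k kml; rewrite /arclength_param/=; congr (curve_fun c _).
exact: subcurve_param.
Qed.

(** Composition with [clamp] extends the parametrization from [0, L] to a
    continuous map on the line. *)
Lemma measurable_arclength_param :
  measurable_fun setT ((gamma \o clamp 0 L) : measurableTypeR R -> g_sigma_algebraType (@open X)).
Proof.
apply: (@measurability _ _ (measurableTypeR R) (g_sigma_algebraType (@open X)) setT _ (@open X)) => //.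
move=> _ [U oU <-]; rewrite setTI; apply: open_measurable.
have : continuous (gamma \o clamp 0 L).
  move=> x; apply/cvg_ballP => e e0; apply/nbhs_ballP; exists e => // y xy.
  rewrite ballEmdist/=; move: xy; rewrite /ball/= => xy.
  apply: le_lt_trans xy; apply: le_trans (clamp_lip 0 L _ _).
  have /andP[x0 xL] := clamp_itv x length_ge0; have /andP[y0 yL] := clamp_itv y length_ge0.
  have [xy|/ltW yx] := leP (clamp 0 L x) (clamp 0 L y).
    by rewrite (le_trans (arclength_param_lip _ _ _))// distrC ler_norm.
  by rewrite metric_sym (le_trans (arclength_param_lip _ _ _))// ler_norm.
by move=> /continuousP; exact.
Qed.

Lemma measurable_along (g : X -> \bar R) :
  measurable_fun setT (g : g_sigma_algebraType (@open X) -> \bar R) ->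
  measurable_fun `[0%R, L] (g \o gamma).
Proof.
move=> mg.
have : measurable_fun setT ((g : g_sigma_algebraType (@open X) -> \bar R) \o (gamma \o clamp 0 L)).
  exact: measurableT_comp mg measurable_arclength_param.
move=> /(measurable_funS measurableT (@subsetT _ `[0%R, L])).
apply: eq_measurable_fun => x; rewrite inE/= in_itv/= => xL.
by rewrite clamp_id.
Qed.

End curves.

(** * Upper gradients *)
Section interval_integrals.
Context {R : realType}.
Notation leb := (@lebesgue_measure R).

Lemma ge0_integral_itv_split (a b c : R) (f : R -> \bar R) :
  (a <= b)%R -> (b <= c)%R -> measurable_fun `[a, c] f ->
  (forall x, (a <= x <= c)%R -> 0 <= f x) ->
  \int[leb]_(x in `[a, c]) f x =
  \int[leb]_(x in `[a, b]) f x + \int[leb]_(x in `[b, c]) f x.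
Proof.
move=> ab bc mf f0.
have mfoc : measurable_fun `]b, c] f.
  apply: measurable_funS mf => // x /=; rewrite !in_itv/= => /andP[bx ->].
  by rewrite (le_trans ab)// ltW.
rewrite -(integral_itv_obnd_cbnd mfoc).
have E : `[a, c]%classic = `[a, b]%classic `|` `]b, c]%classic.
  apply/seteqP; split => x /=; rewrite !in_itv/=.
    move=> /andP[ax xc]; have [xb|bx] := leP x b; first by left; rewrite ax.
    by right.
  move=> [/andP[-> xb]|/andP[bx ->]]; first by rewrite (le_trans xb).
  by rewrite (le_trans ab)// ltW.
rewrite E ge0_integral_setU//; rewrite -?E//.
apply/disj_setPS => x [] /=; rewrite !in_itv/= => /andP[_ xb] /andP[bx _].
by move: bx; rewrite ltNge xb.
Qed.

Lemma ge0_integral_subitv (a b a' b' : R) (f : R -> \bar R) :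
  (a <= a')%R -> (b' <= b)%R -> measurable_fun `[a, b] f ->
  (forall x, (a <= x <= b)%R -> 0 <= f x) ->
  \int[leb]_(x in `[a', b']) f x <= \int[leb]_(x in `[a, b]) f x.
Proof.
move=> aa bb mf f0; apply: ge0_subset_integral => //.
move=> x /=; rewrite !in_itv/= => /andP[ax xb].
  by rewrite (le_trans aa)// (le_trans xb).
Qed.

Lemma le_integral_itv (a b : R) (f g : R -> \bar R) :
  measurable_fun `[a, b] f -> measurable_fun `[a, b] g ->
  (forall x, (a <= x <= b)%R -> 0 <= f x) ->
  (forall x, (a <= x <= b)%R -> f x <= g x) ->
  \int[leb]_(x in `[a, b]) f x <= \int[leb]_(x in `[a, b]) g x.
Proof.
move=> mf mg f0 fg; exact: ge0_le_integral.
Qed.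

Lemma integral_itv_cst (a b r : R) : (a <= b)%R ->
  \int[leb]_(x in `[a, b]) r%:E = (r * (b - a))%:E.
Proof.
move=> ab; rewrite integral_cst//= lebesgue_measure_itv/= lte_fin.
move: ab; rewrite le_eqVlt => /predU1P[->|->]; last by rewrite -EFinB.
by rewrite ltxx subrr mulr0 mule0.
Qed.

End interval_integrals.

Section upper_gradients.
Context {R : realType} {d : measure_display} {X : measurableMetricType d R}.
Implicit Types (u v W : X -> R) (g : X -> \bar R) (c : curve X).
Notation leb := (@lebesgue_measure R).
Local Notation L c := (fine (length c)).
Local Notation gam c := (arclength_param c).

(** Unlike for p-weak upper gradients, no curve is exempted. *)
Definition upper_gradient u g :=
  [/\ borel_fun g, (forall x, 0 <= g x) & forall c,
    `|u (c (curve_left c)) - u (c (curve_right c))|%:E <= line_integral c g].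

Lemma measurable_along_sub c g l m : borel_fun g -> (0 <= l)%R -> (m <= L c)%R ->
  measurable_fun `[l, m] (g \o gam c).
Proof.
move=> mg l0 mL.
apply: measurable_funS (measurable_along mg) => //.
move=> x /=; rewrite !in_itv/= => /andP[lx xm].
by rewrite (le_trans l0)// (le_trans xm).
Qed.

Lemma upper_gradient_sub u g c l m : upper_gradient u g ->
  (0 <= l)%R -> (l <= m)%R -> (m <= L c)%R ->
  `|u (gam c l) - u (gam c m)|%:E <= \int[leb]_(k in `[l, m]) g (gam c k).
Proof.
move=> [mg g0 ug] l0 + mL; rewrite le_eqVlt => /predU1P[<-|lm].
  by rewrite subrr normr0 integral_ge0.
have [c' [c'l c'r c'L c'E]] := subcurve l0 lm mL.
have := ug c'; rewrite c'l c'r => /le_trans; apply.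
rewrite /line_integral c'L.
rewrite -[leRHS](@ge0_integral_shift _ l)//; last exact: measurable_along_sub.
rewrite (_ : [set x | `[l, m]%classic (l + x)%R] = `[0%R, (m - l)%R]%classic); last first.
  by apply/seteqP; split => x /=; rewrite !in_itv/= lerDl lerBrDl.
rewrite le_eqVlt; apply/orP; left; apply/eqP; apply: eq_integral => x.
by rewrite inE/= in_itv/= => xml; rewrite c'E.
Qed.

(** Cut a curve into pieces of length at most [e] and add up. *)
Lemma upper_gradient_local u g (e : R) : (0 < e)%R ->
  borel_fun g -> (forall x, 0 <= g x) ->
  (forall c l m, (0 <= l)%R -> (l < m)%R -> (m <= L c)%R -> (m - l <= e)%R ->
    `|u (gam c l) - u (gam c m)|%:E <= \int[leb]_(k in `[l, m]) g (gam c k)) ->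
  upper_gradient u g.
Proof.
move=> e0 mg g0 H; split => // c.
have {}H l m : (0 <= l)%R -> (l <= m)%R -> (m <= L c)%R -> (m - l <= e)%R ->
    `|u (gam c l) - u (gam c m)|%:E <= \int[leb]_(k in `[l, m]) g (gam c k).
  move=> l0; rewrite le_eqVlt => /predU1P[<-|]; last exact: H.
  by move=> _ _; rewrite subrr normr0 integral_ge0.
suff HN n l m : (0 <= l)%R -> (l <= m)%R -> (m <= L c)%R -> (m - l <= e *+ n)%R ->
    `|u (gam c l) - u (gam c m)|%:E <= \int[leb]_(k in `[l, m]) g (gam c k).
  rewrite -arclength_param_left -arclength_param_right.
  have [n nL] : exists n : nat, (L c / e <= n%:R)%R.
    exists (Num.truncn (L c / e)).+1; apply: ltW.
    by apply: Num.Theory.truncnS_gt; rewrite divr_ge0 ?length_ge0// ltW.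
  apply: (HN n) => //; first exact: length_ge0.
  by rewrite subr0 -mulr_natl -ler_pdivrMr.
elim: n l m => [|n ih] l m l0 lm mL mln.
  by apply: H => //; rewrite (le_trans mln)// mulr0n ltW.
have [mle|/ltW eml] := leP (m - l)%R e; first exact: H.
have lel : (l <= l + e)%R by rewrite lerDl ltW.
have elm : (l + e <= m)%R by rewrite -lerBrDl.
rewrite (@ge0_integral_itv_split _ l (l + e) m)//; last first.
  exact: (@measurable_along_sub c g).
apply: (@le_trans _ _ (`|u (gam c l) - u (gam c (l + e))|%:E +
   `|u (gam c (l + e)%R) - u (gam c m)|%:E)).
  by rewrite -EFinD lee_fin ler_distD.
rewrite leeD//.
  by apply: H => //; [rewrite (le_trans elm)|rewrite addrC addKr].
apply: ih => //; first by rewrite (le_trans l0).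
by rewrite opprD addrA lerBlDr -mulrSr.
Qed.

Lemma le_upper_gradient u g g' : upper_gradient u g -> borel_fun g' ->
  (forall x, g x <= g' x) -> upper_gradient u g'.
Proof.
move=> [mg g0 ug] mg' gg'; split => //.
  by move=> x; rewrite (le_trans (g0 x)).
move=> c; apply: le_trans (ug c) _; apply: le_integral_itv => //.
- exact: measurable_along.
- exact: measurable_along.
Qed.

Lemma upper_gradient_comp u g (phi : R -> R) (k : R) : (0 <= k)%R ->
  (forall s t, `|phi s - phi t| <= k * `|s - t|)%R -> upper_gradient u g ->
  upper_gradient (phi \o u) (fun x => k%:E * g x).
Proof.
move=> k0 phik [mg g0 ug]; split.
- exact: measurable_funeM.
- by move=> x; rewrite mule_ge0.
move=> c; rewrite /line_integral ge0_integralZl_EFin//; last first.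
  exact: measurable_along.
by apply: le_trans (lee_wpmul2l _ (ug c)) => //; rewrite -EFinM lee_fin phik.
Qed.

(** Leibniz rule. The bounds [a] and [b] for [W] and for its Lipschitz constant are
    assumed only between points at distance at most [e], so that they may vary
    with the point. On a piece of curve of length at most [e] from [y] to [z],
      u(y) W(y) - u(z) W(z) = W(y) (u(y) - u(z)) + u(z) (W(y) - W(z)),
    where the first term is at most int a g. In the second one |u(z)| is replaced
    by the values of |u| along the piece; the error is at most int g times
    |W(y) - W(z)| <= 2 a, hence the factor 3 = 1 + 2. *)
Lemma upper_gradientM u g W (a b : X -> R) (e : R) : (0 < e)%R ->
  borel_fun (EFin \o u) -> borel_fun (EFin \o a) -> borel_fun (EFin \o b) ->
  (forall x, 0 <= a x)%R -> (forall x, 0 <= b x)%R ->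
  (forall y z, mdist y z <= e -> `|W y| <= a z)%R ->
  (forall y z z', mdist y z <= e -> mdist y z' <= e ->
    `|W y - W z| <= b z' * mdist y z)%R ->
  upper_gradient u g ->
  upper_gradient (fun x => u x * W x)%R
    (fun x => (3 * a x)%:E * g x + (b x * `|u x|)%:E).
Proof.
move=> e0 mu ma mb a0 b0 Wa Wb ugu; have [mg g0 ug] := ugu.
have mabs : borel_fun (fun x => (`|u x|)%:E) by exact: (measurableT_comp (@abse_measurable R setT) mu).
have m1 : borel_fun (fun x => (a x)%:E * g x) by exact: emeasurable_funM.
have m2 : borel_fun (fun x => (b x * `|u x|)%:E).
  rewrite (_ : (fun x => _) = (fun x => (b x)%:E * `|u x|%:E)).
    exact: emeasurable_funM.
  by apply/funext => x; rewrite EFinM.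
have E3 : (fun x => (3 * a x)%:E * g x) = (fun x => 3%:E * ((a x)%:E * g x)).
  by apply/funext => x; rewrite EFinM muleA.
have m3 : borel_fun (fun x => (3 * a x)%:E * g x).
  by rewrite E3; exact: measurable_funeM.
have mG : borel_fun (fun x => (3 * a x)%:E * g x + (b x * `|u x|)%:E).
  exact: emeasurable_funD.
have ag0 x : 0 <= (a x)%:E * g x by rewrite mule_ge0// lee_fin.
have bu0 x : 0 <= (b x * `|u x|)%:E by rewrite lee_fin mulr_ge0.
apply: (upper_gradient_local e0) => //.
  by move=> x; rewrite adde_ge0// mule_ge0// lee_fin mulr_ge0.
move=> c l m l0 lm mL mle.
have gmdist s t : (l <= s <= m)%R -> (l <= t <= m)%R -> (mdist (gam c s) (gam c t) <= m - l)%R.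
  wlog st : s t / (s <= t)%R.
    move=> H ls lt; have [|/ltW ts] := leP s t; first by move=> /H; exact.
    by rewrite metric_sym H.
  move=> /andP[ls sm] /andP[lt tm].
  rewrite (le_trans (arclength_param_lip _ st _))//; first exact: le_trans ls.
    exact: le_trans mL.
  exact: lerB.
have {}gmdist s t : (l <= s <= m)%R -> (l <= t <= m)%R -> (mdist (gam c s) (gam c t) <= e)%R.
  by move=> ls lt; rewrite (le_trans (gmdist _ _ ls lt)).
have lI : (l <= l <= m)%R by rewrite lexx ltW.
have mI : (l <= m <= m)%R by rewrite lexx ltW.
set A := \int[leb]_(k in `[l, m]) ((a (gam c k))%:E * g (gam c k)).
set J := \int[leb]_(k in `[l, m]) ((b (gam c k) * `|u (gam c k)|)%:E).
set I := \int[leb]_(k in `[l, m]) (g (gam c k)).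
have msub h : borel_fun h -> measurable_fun `[l, m] (h \o gam c).
  by move=> mh; exact: measurable_along_sub.
have -> : \int[leb]_(k in `[l, m]) ((3 * a (gam c k))%:E * g (gam c k) +
    (b (gam c k) * `|u (gam c k)|)%:E) = 3%:E * A + J.
  rewrite (ge0_integralD leb (measurable_itv _) _ (msub _ m3) _ (msub _ m2))//.
    congr (_ + _); rewrite -ge0_integralZl_EFin//; last exact: (msub _ m1).
    by apply: eq_integral => x _; rewrite /= EFinM muleA.
    by move=> x _; rewrite /= mule_ge0// lee_fin mulr_ge0.
  by move=> x _; exact: bu0.
have I0 : 0 <= I by exact: integral_ge0.
have A0 : 0 <= A by exact: integral_ge0.
have J0 : 0 <= J by exact: integral_ge0.
have AI (w : R) : (0 <= w)%R -> (forall k, (l <= k <= m)%R -> w <= a (gam c k))%R ->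
    w%:E * I <= A.
  move=> w0 wa; rewrite -ge0_integralZl_EFin//; last exact: (msub _ mg).
  apply: le_integral_itv.
  - by apply: measurable_funeM; exact: (msub _ mg).
  - exact: (msub _ m1).
  - by move=> x _; rewrite mule_ge0// lee_fin.
  - by move=> x lxm; rewrite lee_wpmul2r// lee_fin wa.
have uI s : (l <= s <= m)%R -> `|u (gam c s) - u (gam c m)|%:E <= I.
  move=> /andP[ls sm]; apply: le_trans (upper_gradient_sub ugu _ sm mL) _.
    exact: le_trans ls.
  by apply: ge0_integral_subitv => //; exact: (msub _ mg).
pose D : R := `|W (gam c l) - W (gam c m)|%R.
have D0 : (0 <= D)%R by exact: normr_ge0.
have Da k : (l <= k <= m)%R -> (D <= a (gam c k) + a (gam c k))%R.
  by move=> lk; rewrite (le_trans (ler_normB _ _))// lerD// Wa// gmdist.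
have DI : D%:E * I <= 2%:E * A.
  have -> : D = (2 * (D / 2))%R by rewrite mulrCA divff ?mulr1.
  rewrite EFinM -muleA lee_wpmul2l// AI ?divr_ge0// => k lk.
  by rewrite ler_pdivrMr// (le_trans (Da _ lk))// mulr_natr mulr2n.
have W1 : `|W (gam c l)|%:E * I <= A.
  by apply: AI => // k lk; rewrite Wa// gmdist.
apply: (@le_trans _ _ (`|W (gam c l)|%:E * I + (`|u (gam c m)| * D)%:E)).
  apply: (@le_trans _ _ (`|W (gam c l)|%:E * `|u (gam c l) - u (gam c m)|%:E +
      (`|u (gam c m)| * D)%:E)); last first.
    by rewrite leeD2r// lee_wpmul2l// uI.
  rewrite -EFinM -EFinD lee_fin /D -!normrM.
  apply: le_trans (ler_normD _ _); rewrite le_eqVlt; apply/orP; left.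
  by apply/eqP; congr (`|_|)%R; ring.
have -> : 3%:E * A + J = A + (2%:E * A + J).
  have -> : 3%:E = 1%:E + 2%:E :> \bar R by rewrite -EFinD; congr EFin; ring.
  by rewrite ge0_muleDl// mul1e -addeA.
rewrite leeD//.
have [->|Jfin] := eqVneq J +oo.
  by rewrite addey ?leey// -ltNye (lt_le_trans (ltNyr 0%R))// mule_ge0.
have {}Jfin : J \is a fin_num by rewrite ge0_fin_numE// ltey.
apply: (@le_trans _ _ (D%:E * I + J)); last by rewrite leeD2r.
have [DIoo|DIfin] := eqVneq (D%:E * I) +oo.
  by rewrite DIoo addye ?leey// -ltNye (lt_le_trans (ltNyr 0%R)).
have {}DIfin : D%:E * I \is a fin_num.
  by rewrite ge0_fin_numE ?ltey// mule_ge0// lee_fin.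
set q := fine (D%:E * I).
have -> : D%:E * I = q%:E by rewrite fineK.
rewrite -leeBlDl//.
have ml0 : (0 < m - l)%R by rewrite subr_gt0.
set w := (`|u (gam c m)| * D - q)%R.
rewrite -EFinB -/w.
have [w0|/ltW w0] := leP 0%R w; last by rewrite (le_trans _ J0)// lee_fin.
have -> : w = ((w / (m - l)) * (m - l))%R by rewrite divfK ?gt_eqF.
rewrite -integral_itv_cst ?(ltW lm)//; apply: le_integral_itv => //.
- exact: (msub _ m2).
- by move=> x _; rewrite lee_fin divr_ge0// ltW.
move=> k lk; rewrite lee_fin ler_pdivrMr//.
rewrite /w lerBlDr.
have /andP[lk1 km] := lk.
apply: (@le_trans _ _ (`|u (gam c k)| * D + D * `|u (gam c k) - u (gam c m)|)%R).
  rewrite (mulrC D) -mulrDl ler_wpM2r// /D//.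
  by rewrite -{1}(subKr (u (gam c k)) (u (gam c m))) ler_normB.
rewrite lerD//.
  rewrite mulrC mulrAC ler_wpM2r//.
  rewrite (le_trans (Wb _ _ (gam c k) _ _)) ?gmdist//.
  rewrite ler_wpM2l// (le_trans (arclength_param_lip _ _ _))//.
  exact: ltW.
by rewrite -lee_fin /q fineK// EFinM lee_wpmul2l ?uI.
Qed.


Lemma LipP u : Lip u -> exists2 K : R, (0 < K)%R &
  forall x y, (`|u x - u y| <= K * mdist x y)%R.
Proof.
move=> [K uK]; exists (`|K| + 1)%R; first by rewrite ltr_wpDl.
move=> x y; apply: le_trans (uK x y) _; rewrite ler_wpM2r ?mdist_ge0//.
by rewrite (le_trans (ler_norm K))// lerDl.
Qed.

Lemma mdist_continuous (x : X) : continuous (fun y => mdist x y : R).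
Proof.
move=> y; apply/cvgrPdist_lt => e e0; apply/nbhs_ballP; exists e => // z.
rewrite ballEmdist/= => yz; apply: le_lt_trans yz.
rewrite ler_norml lerBlDr lerNl opprB lerBlDr addrC metric_triangle/=.
by rewrite (metric_sym y z) addrC metric_triangle.
Qed.

Lemma Lip_continuous u : Lip u -> continuous u.
Proof.
move=> /LipP[K K0 uK] x; apply/cvgrPdist_lt => e e0.
apply/nbhs_ballP; exists (e / K)%R; first by rewrite /= divr_gt0.
move=> y; rewrite ballEmdist/= ltr_pdivlMr// => xy.
by rewrite (le_lt_trans (uK _ _))// mulrC.
Qed.

Lemma continuous_borel u : continuous u -> borel_fun (EFin \o u).
Proof.
move=> uc; apply: (@measurable_EFinP _ (g_sigma_algebraType (@open X)) _ setT u).2.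
apply: (@measurability _ _ (g_sigma_algebraType (@open X)) _ setT u _
  (RGenOpens.measurableE R)).
move=> _ [_ [a [b ->] <-]]; rewrite setTI; apply: sub_sigma_algebra.
by move/continuousP : uc; apply; exact: interval_open.
Qed.

(** On a curve, only the parts before the first zero and after the last zero of
    [v] matter, and [v] has no zero there. *)
Lemma upper_gradient_restrict v g : Lip v -> upper_gradient v g ->
  upper_gradient v (g \_ [set x | v x != 0%R]).
Proof.
move=> vLip ugv; have [mg g0 ug] := ugv.
set Z := [set x | v x != 0%R].
have oZ : open Z.
  rewrite (_ : Z = v @^-1` [set~ 0%R]); last first.
    by apply/seteqP; split => x /=; [move/eqP|move=> ?; apply/eqP].
  have /continuousP := Lip_continuous vLip; apply.
  by rewrite openC; exact: closed_eq.
have mZ : measurable (Z : set (g_sigma_algebraType (@open X))).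
  exact: sub_sigma_algebra.
have mgZ : borel_fun (g \_ Z).
  by apply/(measurable_restrictT _ mZ); apply: measurable_funS mg.
have gZ0 x : 0 <= (g \_ Z) x by rewrite patchE; case: ifP.
split => // c.
have [K K0 vK] := LipP vLip.
pose L := fine (length c); have L0 : (0 <= L)%R by exact: length_ge0.
pose f l := v (gam c l).
have fK l m : (0 <= l)%R -> (l <= m)%R -> (m <= L)%R ->
    (`|f l - f m| <= K * (m - l))%R.
  move=> l0 lm mL; rewrite (le_trans (vK _ _))// ler_pM2l//.
  exact: arclength_param_lip.
rewrite -arclength_param_left -arclength_param_right -/(f 0%R) -/L -/(f L).
have gE l m : (0 <= l)%R -> (m <= L)%R ->
    (forall k, (l < k < m)%R -> f k != 0%R) ->
    \int[leb]_(k in `[l, m]) g (gam c k) =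
    \int[leb]_(k in `[l, m]) (g \_ Z) (gam c k).
  move=> l0 mL fZ.
  have mo h : borel_fun h -> measurable_fun `]l, m[ (h \o gam c).
    move=> mh; apply: measurable_funS (measurable_along_sub mh l0 mL) => //.
    by move=> x /=; rewrite !in_itv/= => /andP[/ltW -> /ltW].
  rewrite (integral_itv_bndoo _ _ (mo _ mg)) (integral_itv_bndoo _ _ (mo _ mgZ)).
  apply: eq_integral => k; rewrite inE/= in_itv/= => lk.
  by rewrite patchE mem_set//; exact: fZ.
pose S := [set l | (0 <= l <= L)%R /\ f l = 0%R].
have [S0|/set0P S0] := eqVneq S set0.
  rewrite /line_integral -/L -gE//; first exact: upper_gradient_sub.
  move=> k /andP[/ltW k0 /ltW kL]; apply/eqP => fk0.
  by have : S k; [rewrite /S/= k0 kL|rewrite S0].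
have lbS : has_lbound S by exists 0%R => l [/andP[]].
have ubS : has_ubound S by exists L => l [/andP[]].
have [s1 s1S] := S0.
have iS l : S l -> (inf S <= l)%R by move=> Sl; exact: ge_inf.
have sS l : S l -> (l <= sup S)%R by move=> Sl; exact: ub_le_sup.
have i0 : (0 <= inf S)%R by apply: lb_le_inf => // l [/andP[]].
have sL : (sup S <= L)%R by apply: ge_sup => // l [/andP[]].
have is_ : (inf S <= sup S)%R by rewrite (le_trans (iS _ s1S))// sS.
have fi : f (inf S) = 0%R.
  apply/eqP; rewrite -normr_eq0 eq_le normr_ge0 andbT.
  apply/ler_addgt0Pr => e e0; rewrite add0r.
  have eK : (0 < e / K)%R by rewrite divr_gt0.
  have [l [/andP[l0 lL] fl] li] := inf_adherent eK (conj S0 lbS).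
  have lS : S l by split => //; rewrite l0.
  rewrite -[f _]subr0 -fl (le_trans (fK _ _ _ _ _))// ?iS//.
  by rewrite mulrC -ler_pdivlMr// lerBlDl ltW.
have fs : f (sup S) = 0%R.
  apply/eqP; rewrite -normr_eq0 eq_le normr_ge0 andbT.
  apply/ler_addgt0Pr => e e0; rewrite add0r.
  have eK : (0 < e / K)%R by rewrite divr_gt0.
  have [l [/andP[l0 lL] fl] li] := sup_adherent eK (conj S0 ubS).
  have lS : S l by split => //; rewrite l0.
  rewrite -[f _]subr0 -fl distrC (le_trans (fK _ _ _ _ _))// ?sS//.
  by rewrite mulrC -ler_pdivlMr// lerBlDr -lerBlDl ltW.
have iL := le_trans is_ sL; have s0 := le_trans i0 is_.
apply: (@le_trans _ _ (`|f 0%R - f (inf S)|%:E + `|f (sup S) - f L|%:E)).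
  by rewrite -EFinD lee_fin fi fs subr0 sub0r normrN ler_normB.
have mL : measurable_fun `[0%R, L] ((g \_ Z) \o gam c) by exact: measurable_along.
rewrite /line_integral -/L (ge0_integral_itv_split i0 iL mL); last first.
  by move=> k _; exact: gZ0.
rewrite leeD//.
  rewrite -gE//; first exact: upper_gradient_sub.
  move=> k /andP[/ltW k0 ki]; apply/eqP => fk0; move: (ki); apply/negP.
  by rewrite -leNgt iS//; split => //; rewrite k0/= (le_trans _ iL)// ltW.
apply: (@le_trans _ _ (\int[leb]_(k in `[sup S, L]) (g \_ Z) (gam c k))).
  rewrite -gE//; first exact: upper_gradient_sub.
  move=> k /andP[sk /ltW kL]; apply/eqP => fk0; move: (sk); apply/negP.
  by rewrite -leNgt sS//; split => //; rewrite kL/= (le_trans s0)// ltW.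
apply: ge0_integral_subitv => //.
exact: measurable_along_sub.
Qed.

End upper_gradients.

(** * Powers and integrals *)
Section poweR_lemmas.
Context {R : realType}.

Lemma le_poweR (p : R) (x y : \bar R) : (0 <= p)%R -> 0 <= x -> x <= y ->
  x `^ p <= y `^ p.
Proof.
move=> p0 x0 xy; apply: gt0_ler_poweR => //; rewrite in_itv/= leey andbT//.
exact: le_trans xy.
Qed.

Lemma poweRD_le (p : R) (x y : \bar R) : (0 <= p)%R -> 0 <= x -> 0 <= y ->
  (x + y) `^ p <= (2 `^ p)%:E * (x `^ p + y `^ p).
Proof.
move=> p0; wlog xy : x y / x <= y.
  move=> H x0 y0; have [|/ltW yx] := leP x y; first by move=> /H; exact.
  by rewrite addeC [X in _ * X]addeC H.
move=> x0 y0; apply: (@le_trans _ _ ((2%:E * y) `^ p)).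
  apply: le_poweR => //; first exact: adde_ge0.
  have -> : 2%:E = 1%:E + 1%:E :> \bar R by rewrite -EFinD.
  by rewrite ge0_muleDl// mul1e leeD2r.
rewrite poweRM// poweR_EFin lee_wpmul2l// ?lee_fin ?powR_ge0//.
by rewrite leeDr// poweR_ge0.
Qed.

Lemma poweR_EFinM (p k : R) (x : \bar R) : (0 <= k)%R -> 0 <= x ->
  (k%:E * x) `^ p = (k `^ p)%:E * x `^ p.
Proof. by move=> k0 x0; rewrite poweRM// poweR_EFin. Qed.

End poweR_lemmas.

Section nonmeasurable.
Import HBNNSimple.

(** The integral of a nonnegative function is a supremum over simple functions
    below it, hence monotone with no measurability assumption. *)
Lemma ge0_le_integral_nonmeasurable d (T : measurableType d) (R : realType)
    (mu : {measure set T -> \bar R}) (D : set T) (f g : T -> \bar R) :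
  (forall x, 0 <= f x) -> (forall x, f x <= g x) ->
  \int[mu]_(x in D) f x <= \int[mu]_(x in D) g x.
Proof.
move=> f0 fg; have g0 x : 0 <= g x by exact: le_trans (f0 x) (fg x).
rewrite !ge0_integralE//; apply: ge_ereal_sup => _ [h hf <-].
apply: ereal_sup_ubound; exists h => // x; apply: le_trans (hf x) _.
by rewrite !patchE; case: ifP.
Qed.

Lemma ge0_le_integral_sets d (T : measurableType d) (R : realType)
    (mu : {measure set T -> \bar R}) (D E : set T) (f g : T -> \bar R) :
  (forall x, 0 <= f x) -> (forall x, 0 <= g x) ->
  (forall x, D x -> E x -> f x <= g x) -> (forall x, D x -> ~ E x -> f x = 0) ->
  \int[mu]_(x in D) f x <= \int[mu]_(x in E) g x.
Proof.
move=> f0 g0 fg fE; rewrite integral_mkcond [leRHS]integral_mkcond.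
apply: ge0_le_integral_nonmeasurable => x; rewrite !patchE.
  by case: ifP.
case: ifPn => [/set_mem Dx|_]; last by case: ifP.
by case: ifPn => [/set_mem Ex|/negP Ex]; [exact: fg|rewrite fE// => /mem_set].
Qed.

End nonmeasurable.

(** * From weak to genuine upper gradients *)
Section metric_measure_space.
Context {R : realType} {d : measure_display} {X : measurableMetricType d R}.
Variable mu : {measure set X -> \bar R}.
Hypotheses (mu_borel : borel_regular_complete mu)
  (mu_balls : finite_positive_on_balls mu).

Lemma borel_measurable (A : set X) : borel_set A -> measurable A.
Proof. by case: mu_borel => + _ _; apply. Qed.

Lemma ball_open_metric (x : X) (r : R) : open (ball x r).
Proof.
have -> : ball x r = (fun y => mdist x y : R) @^-1` [set t | t < r]%R.
  by rewrite ballEmdist.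
by have /continuousP := @mdist_continuous _ _ _ x; apply; exact: open_lt.
Qed.

Lemma ball_borel (x : X) (r : R) : borel_set (ball x r).
Proof. by apply: sub_sigma_algebra; exact: ball_open_metric. Qed.

Lemma measurable_ballX (x : X) (r : R) : measurable (ball x r).
Proof. exact: borel_measurable (ball_borel x r). Qed.

Lemma borel_fun_measurable (g : X -> \bar R) : borel_fun g -> measurable_fun setT g.
Proof.
by move=> mg _ Y mY; apply: borel_measurable; apply: mg.
Qed.

Lemma finite_hull (A : set X) : measurable A -> mu A < +oo ->
  exists H, [/\ borel_set H, A `<=` H & mu.-negligible (H `\` A)].
Proof.
move=> mA Afin; case: mu_borel => _ _ /(_ A)[H [bH AH]].
rewrite measurable_mu_extE// => HA; exists H; split => //.
have mH := borel_measurable bH.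
exists (H `\` A); split => //; first exact: measurableD.
have Hfin : mu H < +oo by rewrite HA.
have -> : mu (H `\` A) = mu H - mu (H `&` A) by exact: measureD.
by rewrite (setIidr AH) HA subee// ge0_fin_numE.
Qed.

(** Replace the superlevel sets of [g] at rational heights, cut into pieces of
    finite measure, by Borel hulls. The supremum of the corresponding multiples of
    indicator functions is Borel and differs from [g] only on the countable union
    of the null sets by which the hulls exceed the pieces. *)
Lemma borel_majorant (g : X -> \bar R) : measurable_fun setT g ->
  (forall x, 0 <= g x) -> exists g' : X -> \bar R,
  [/\ borel_fun g', (forall x, g x <= g' x) & {ae mu, forall x, g' x = g x}].
Proof.
move=> mg g0.
pose A (qn : rat * nat) := [set x | (ratr qn.1)%:E < g x] `&` ball point (qn.2.+1)%:R.
have mA qn : measurable (A qn).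
  apply: measurableI; last exact: measurable_ballX.
  rewrite -[X in measurable X]setTI; exact: emeasurable_fun_o_infty.
have Afin qn : mu (A qn) < +oo.
  have /andP[_] := mu_balls point (ltr0Sn R qn.2).
  apply: le_lt_trans; apply: le_measure; rewrite ?inE//.
    exact: measurable_ballX.
  by move=> x [].
have /choice[H HP] qn := finite_hull (mA qn) (Afin qn).
pose h (j : nat) (x : X) : \bar R := if unpickle j is Some qn then
  (ratr qn.1)%:E * (\1_(H qn) x)%:E else 0.
pose g' (x : X) := esups (h ^~ x) 0%N.
have hle j x : h j x <= g' x by apply: ereal_sup_ubound; exists j.
have gg' x : g x <= g' x.
  rewrite leNgt; apply/negP => g'g.
  have [q /andP[q1 q2]] : exists q : rat, (g' x < (ratr q)%:E) && ((ratr q)%:E < g x).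
    have g'0 : (exists s : R, g' x <= s%:E < g x).
      move: g'g; case: (g x) (g0 x) => [b|_|//]; case: (g' x) => [a|//|] _.
      - by move=> ab; exists a; rewrite lexx.
      - by move=> _; exists (b - 1)%R; rewrite leNye/= lte_fin ltrBlDr ltrDl.
      - by exists a; rewrite lexx/= ltry.
      - by exists 0%R; rewrite leNye/= ltry.
    have [s /andP[g's sg]] := g'0.
    have [t st tg] : exists2 t : R, (s < t)%R & t%:E <= g x.
      move: sg; case: (g x) => [b|_|//]; first by rewrite lte_fin => ?; exists b.
      by exists (s + 1)%R; rewrite ?ltrDl// leey.
    have [q] := rat_in_itvoo st; rewrite in_itv/= => /andP[sq qt].
    exists q; rewrite (le_lt_trans g's) ?lte_fin//=.
    by apply: lt_le_trans tg; rewrite lte_fin.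
  pose n := Num.truncn (mdist point x : R).
  have xA : A (q, n) x.
    by split => //; rewrite ballEmdist/=; exact: Num.Theory.truncnS_gt.
  have [_ /(_ _ xA) xH _] := HP (q, n).
  have := hle (pickle (q, n)) x; rewrite /h pickleK indicE mem_set// mule1.
  by rewrite leNgt q1.
exists g'; split => //.
  apply: measurable_fun_esups => j; rewrite /h; case: (unpickle j) => [qn|].
    apply: measurable_funeM; apply/measurable_EFinP.
    by apply: measurable_indic; case: (HP qn).
  exact: measurable_cst.
pose N := \bigcup_j if unpickle j is Some qn then H qn `\` A qn else set0.
have : mu.-negligible N.
  apply: negligible_bigcup => j; case: (unpickle j) => [qn|].
    by case: (HP qn).
  exact: negligible_set0.
apply: negligibleS => x /= g'x; apply: contrapT => xN; apply: g'x.
apply/eqP; rewrite eq_le gg' andbT; apply: ge_ereal_sup => _ [j _ <-].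
rewrite /h; case Ej : (unpickle j) => [qn|]; last exact: g0.
rewrite indicE; have [|_] := boolP (x \in H qn); last by rewrite mule0.
rewrite inE mule1 => xH; apply: ltW.
suff [] : A qn x by [].
by apply: contrapT => xA; apply: xN; exists j => //; rewrite Ej.
Qed.

(** To a Borel majorant that equals [g] almost everywhere, add a small multiple of
    the function whose integral is infinite along the exceptional curves. *)
Lemma weak_upper_gradient_strong (p : R) (u : X -> R) (g : X -> \bar R) (e : R) :
  (0 < p)%R -> weak_upper_gradient mu p (EFin \o u) g -> (0 < e)%R ->
  exists2 g', upper_gradient u g' & forall A, measurable A ->
    \int[mu]_(x in A) (g' x `^ p) <=
    (2 `^ p)%:E * \int[mu]_(x in A) (g x `^ p) + e%:E.
Proof.
move=> p0 [mg g0 [rho [mrho rho0 rhofin rhoP]]] e0.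
have [h [mh gh hg]] := borel_majorant mg g0.
have h0 x : 0 <= h x by rewrite (le_trans (g0 x)).
set I := \int[mu]_x (rho x `^ p) in rhofin.
have I0 : 0 <= I by apply: integral_ge0 => x _; exact: poweR_ge0.
have Ifin : I \is a fin_num by rewrite ge0_fin_numE.
have P0 : (0 < 2 `^ p :> R)%R by rewrite powR_gt0.
pose s : R := (e / (2 `^ p * (fine I + 1)))%R.
have I10 : (0 < fine I + 1)%R by rewrite ltr_wpDl// fine_ge0.
have s0 : (0 < s)%R by rewrite divr_gt0// mulr_gt0.
pose t : R := (s `^ p^-1)%R.
have t0 : (0 < t)%R by rewrite powR_gt0.
have tp : (t `^ p = s)%R by rewrite /t -powRrM mulVf ?gt_eqF// powRr1// ltW.
have mtrho : borel_fun (fun x => t%:E * rho x) by exact: measurable_funeM.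
have trho0 x : 0 <= t%:E * rho x by rewrite mule_ge0// lee_fin ltW.
exists (fun x => h x + t%:E * rho x).
  split => [||c]; [exact: emeasurable_funD|by move=> x; exact: adde_ge0|].
  have mhc := measurable_along mh (c := c); have mrc := measurable_along mtrho (c := c).
  have [gc|/rhoP rc] := pselect (upper_gradient_along (EFin \o u) g c).
    move: gc; rewrite /upper_gradient_along/= => /le_trans; apply.
    apply: (@le_trans _ _ (line_integral c h)).
      exact: ge0_le_integral_nonmeasurable.
    have msum := emeasurable_funD mhc mrc.
    by apply: le_integral_itv => // k _ /=; rewrite leeDl.
  rewrite /line_integral ge0_integralD//.
  rewrite ge0_integralZl_EFin ?(ltW t0)//; last exact: measurable_along.
  rewrite [leRHS](_ : _ = line_integral c h + t%:E * line_integral c rho)//.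
  rewrite rc gt0_muley ?lte_fin// addey ?leey// -ltNye.
  by rewrite (lt_le_trans (ltNyr 0%R))// integral_ge0.
move=> A mA.
have mpow f : measurable_fun setT f -> measurable_fun A (fun x : X => f x `^ p).
  move=> mf; apply: measurable_funS (@subsetT _ A) _ => //.
  exact: measurableT_comp (measurable_poweR p) mf.
have mh' := borel_fun_measurable mh; have mr' := borel_fun_measurable mrho.
have mtr' := borel_fun_measurable mtrho.
apply: (@le_trans _ _ (\int[mu]_(x in A) ((2 `^ p)%:E * (h x `^ p + (t%:E * rho x) `^ p)))).
  apply: ge0_le_integral => //.
  - by move=> x _; exact: poweR_ge0.
  - by apply: mpow; exact: emeasurable_funD.
  - by apply: measurable_funeM; apply: emeasurable_funD; exact: mpow.
  - by move=> x _; apply: poweRD_le => //; exact: ltW.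
rewrite ge0_integralZl_EFin//; last 2 first.
- by move=> x _; rewrite adde_ge0// poweR_ge0.
- by apply: emeasurable_funD; exact: mpow.
rewrite ge0_integralD//; last 4 first.
- by move=> x _; exact: poweR_ge0.
- exact: mpow.
- by move=> x _; exact: poweR_ge0.
- exact: mpow.
rewrite ge0_muleDr ?integral_ge0//; try by move=> x _; exact: poweR_ge0.
apply: leeD.
  rewrite lee_wpmul2l ?lee_fin ?(ltW P0)// le_eqVlt; apply/orP; left; apply/eqP.
  apply: ae_eq_integral => //; [exact: mpow|exact: mpow|].
  by apply: filterS hg => x hgx _; rewrite hgx.
apply: (@le_trans _ _ ((2 `^ p)%:E * (s%:E * I))).
  rewrite lee_wpmul2l ?lee_fin ?(ltW P0)//.
  under eq_integral do rewrite poweR_EFinM ?(ltW t0)// tp.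
  rewrite ge0_integralZl_EFin ?(ltW s0)//; last 2 first.
  - by move=> x _; exact: poweR_ge0.
  - exact: mpow.
  rewrite lee_wpmul2l ?lee_fin ?(ltW s0)// /I; apply: ge0_subset_integral => //.
  - exact: measurableT_comp (measurable_poweR p) mr'.
  - by move=> x _; exact: poweR_ge0.
rewrite -[I]fineK// -!EFinM lee_fin /s.
have -> : (2 `^ p * (e / (2 `^ p * (fine I + 1)) * fine I) =
    e * (fine I / (fine I + 1)))%R by field; rewrite !gt_eqF.
by rewrite ler_piMr ?(ltW e0)// ler_pdivrMr// mul1r lerDl.
Qed.

Lemma upper_gradient_weak (p : R) (u : X -> R) (g : X -> \bar R) :
  (0 < p)%R -> upper_gradient u g -> weak_upper_gradient mu p (EFin \o u) g.
Proof.
move=> p0 [mg g0 ug]; split => //; first exact: borel_fun_measurable.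
exists (cst 0); split => //.
- exact: measurable_cst.
- by under eq_integral do rewrite poweR0r ?gt_eqF//; rewrite integral0.
- by move=> c; case; rewrite /upper_gradient_along/=.
Qed.

(** * Balls and the Poincare inequality *)

Lemma Lip_borel (u : X -> R) : Lip u -> borel_fun (EFin \o u).
Proof. by move=> /Lip_continuous/continuous_borel. Qed.

Definition ball_mass (x : X) (r : R) := fine (mu (ball x r)).

Lemma ball_massE (x : X) (r : R) : (0 < r)%R -> mu (ball x r) = (ball_mass x r)%:E.
Proof.
move=> r0; have /andP[m0 moo] := mu_balls x r0.
by rewrite /ball_mass fineK// ge0_fin_numE// ltW.
Qed.

Lemma ball_mass_gt0 (x : X) (r : R) : (0 < r)%R -> (0 < ball_mass x r)%R.
Proof.
by move=> r0; rewrite -lte_fin -ball_massE//; case/andP: (mu_balls x r0).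
Qed.

Lemma ball_mass_le (x : X) (r : R) (y : X) (s : R) : (0 < r)%R -> (0 < s)%R -> ball x r `<=` ball y s ->
  (ball_mass x r <= ball_mass y s)%R.
Proof.
move=> r0 s0 rs; rewrite -lee_fin -!ball_massE//.
by apply: le_measure => //; rewrite inE; exact: measurable_ballX.
Qed.

Lemma ballP (x y : X) (r : R) : ball x r y <-> (mdist x y < r)%R.
Proof. by rewrite ballEmdist. Qed.

Lemma sub_ball (x y : X) (r s : R) : (mdist x y + s <= r)%R -> ball y s `<=` ball x r.
Proof.
move=> xys z /ballP yz; apply/ballP.
by rewrite (le_lt_trans (metric_triangle x y z))// (lt_le_trans _ xys)// ltrD2l.
Qed.

Lemma average_ballE (x : X) (r : R) (f : X -> \bar R) : (0 < r)%R ->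
  average mu (ball x r) f = ((ball_mass x r)^-1)%:E * \int[mu]_(y in ball x r) f y.
Proof. by move=> r0; rewrite /average ball_massE// inver gt_eqF ?ball_mass_gt0. Qed.

Lemma ball_center_metric (x : X) (r : R) : (0 < r)%R -> ball x r x.
Proof. by move=> r0; apply/ballP; rewrite mdistxx. Qed.

Lemma Lip_ball_bounded (u : X -> R) (x : X) (r : R) : Lip u ->
  exists2 M : R, (0 <= M)%R & forall y, ball x r y -> (`|u y| <= M)%R.
Proof.
move=> /LipP[K K0 uK]; exists (`|u x| + K * `|r|)%R.
  by rewrite addr_ge0// mulr_ge0// ltW.
move=> y /ballP xy; rewrite -[X in `|X|%R](subrKC (u x)).
rewrite (le_trans (ler_normD _ _))// lerD2l distrC (le_trans (uK _ _))// ler_pM2l//.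
by rewrite (le_trans (ltW xy))// ler_norm.
Qed.

Lemma diam_ball_le (x : X) (r : R) : (0 < r)%R -> diam (ball x r) <= (2 * r)%:E.
Proof.
move=> r0; apply: ge_ereal_sup => _ [[y z] [/= /ballP xy /ballP xz] <-].
rewrite lee_fin (le_trans (metric_triangle y x z))// metric_sym.
by rewrite mulr2n mulrDl mul1r lerD ?ltW.
Qed.

Lemma integral_const_ball (x : X) (r k : R) : (0 < r)%R ->
  \int[mu]_(y in ball x r) k%:E = (k * ball_mass x r)%:E.
Proof.
move=> r0; rewrite integral_cst//=; last exact: measurable_ballX.
by rewrite ball_massE.
Qed.

(** The Poincare inequality for Lipschitz functions and genuine upper gradients,
    freed from averages: only some centring constant [m] is remembered. *)
Lemma poincare_Lip (p tau : R) : (1 < p)%R -> (1 <= tau)%R -> poincare mu p p tau ->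
  exists2 C : R, (0 < C)%R & forall (x : X) (r : R) u g, (0 < r)%R -> Lip u ->
    upper_gradient u g -> exists m : R,
    \int[mu]_(y in ball x r) (`|u y - m| `^ p)%:E <=
    (C * r `^ p)%:E * \int[mu]_(y in ball x (tau * r)) (g y `^ p).
Proof.
move=> p1 tau1 [C [C0 PI]]; have p0 : (0 < p)%R := lt_trans ltr01 p1.
exists (C * 2 `^ p)%R; first by rewrite mulr_gt0// powR_gt0.
move=> x r u g r0 uLip ugu; have [mg g0 _] := ugu.
have mu' := Lip_borel uLip; have muX := borel_fun_measurable mu'.
set B := ball x r; have mB : measurable B by exact: measurable_ballX.
have muB : measurable_fun B (EFin \o u) by exact: measurable_funS muX.
have [M M0 uM] := Lip_ball_bounded x r uLip.
have intu : mu.-integrable B (EFin \o u).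
  apply/integrableP; split => //.
  apply: (@le_lt_trans _ _ (\int[mu]_(y in B) M%:E)).
    by apply: ge0_le_integral => //; exact: measurableT_comp.
  by rewrite integral_const_ball// ltry.
have Mx0 := ball_mass_gt0 x r0.
have [m mE] : exists m, average mu B (EFin \o u) = m%:E.
  rewrite average_ballE//; exists ((ball_mass x r)^-1 *
    fine (\int[mu]_(y in B) (EFin \o u) y))%R.
  by rewrite EFinM fineK//; exact: integrable_fin_num.
have tau0 : (0 < tau)%R := lt_le_trans ltr01 tau1.
have tr0 : (0 < tau * r)%R by rewrite mulr_gt0.
exists m; have := PI x r r0 (EFin \o u) g muX (upper_gradient_weak p0 ugu).
rewrite /mean_oscillation -/B asboolT; last first.
  by left; apply: integral_funepos_lt_pinfty.
rewrite divff ?gt_eqF// poweRe1; last first.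
  rewrite average_ballE// mule_ge0// ?lee_fin ?invr_ge0 ?(ltW Mx0)//.
  by apply: integral_ge0 => y _; exact: poweR_ge0.
rewrite mE !average_ballE//.
set I := \int[mu]_(y in B) _; set J := \int[mu]_(y in ball x (tau * r)) _.
have I0 : 0 <= I by apply: integral_ge0 => y _; rewrite lee_fin powR_ge0.
have J0 : 0 <= J by apply: integral_ge0 => y _; exact: poweR_ge0.
have diam0 : 0 <= diam B.
  apply: ereal_sup_ubound; exists (x, x); rewrite /= ?mdistxx//.
  by split; exact: ball_center_metric.
move=> H.
have -> : I = (ball_mass x r)%:E * ((ball_mass x r)^-1%:E * I).
  by rewrite muleA -EFinM divff ?mul1e// gt_eqF.
apply: le_trans (lee_wpmul2l _ H) _; first by rewrite lee_fin ltW.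
rewrite !muleA lee_wpmul2r//.
have dp : diam B `^ p <= ((2 * r) `^ p)%:E.
  rewrite -poweR_EFin; apply: le_poweR => //; first exact: ltW.
  exact: diam_ball_le.
apply: (@le_trans _ _ ((ball_mass x r)%:E * C%:E * ((2 * r) `^ p)%:E * (ball_mass x (tau * r))^-1%:E)).
  rewrite lee_wpmul2r ?lee_fin ?invr_ge0 ?(ltW (ball_mass_gt0 _ _))//.
  by rewrite lee_wpmul2l// -EFinM lee_fin mulr_ge0 ?ltW.
rewrite -!EFinM lee_fin powRM ?(ltW r0)//.
rewrite (_ : _ / _ = C * 2 `^ p * r `^ p *
    (ball_mass x r / ball_mass x (tau * r)))%R; last by ring.
rewrite ler_piMr//; first by rewrite !mulr_ge0 ?powR_ge0// ltW.
rewrite ler_pdivrMr ?ball_mass_gt0// mul1r ball_mass_le//.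
by apply: sub_ball; rewrite mdistxx add0r ler_peMl// ltW.
Qed.

(** * Measurability, Lipschitz functions and cutoff functions *)

Lemma borel_powR (p : R) (u : X -> R) : borel_fun (EFin \o u) ->
  borel_fun (fun y => (`|u y| `^ p)%:E).
Proof.
move=> mu'; have -> : (fun y => (`|u y| `^ p)%:E) =
    (fun e : \bar R => e `^ p) \o abse \o (EFin \o u).
  by apply/funext => y /=.
apply: measurableT_comp => //; apply: measurableT_comp (measurable_poweR p) _.
exact: abse_measurable.
Qed.

Lemma borel_poweR (p : R) (g : X -> \bar R) : borel_fun g ->
  borel_fun (fun y => g y `^ p).
Proof. by move=> mg; exact: measurableT_comp (measurable_poweR p) mg. Qed.

Lemma borel_restrict (A : set X) (g : X -> \bar R) : borel_set A -> borel_fun g ->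
  borel_fun (g \_ A).
Proof.
move=> bA mg; have mA : measurable (A : set (g_sigma_algebraType (@open X))) := bA.
by apply/(measurable_restrictT _ mA); exact: measurable_funS mg.
Qed.

Lemma le_integral_set (D E : set X) (f g : X -> \bar R) :
  (forall y, 0 <= f y) -> (forall y, 0 <= g y) ->
  D `<=` E -> (forall y, D y -> f y <= g y) ->
  \int[mu]_(y in D) f y <= \int[mu]_(y in E) g y.
Proof.
move=> f0 g0 DE fg; apply: ge0_le_integral_sets => // y Dy; first by move=> _; exact: fg.
by move=> /(_ (DE y Dy)).
Qed.

Lemma LipD_const (u : X -> R) (k : R) : Lip u -> Lip (fun y => u y - k)%R.
Proof. by move=> [K uK]; exists K => x y; rewrite opprB addrA subrK. Qed.

Lemma Lip_comp (u : X -> R) (phi : R -> R) (k : R) : (0 <= k)%R ->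
  (forall s t, `|phi s - phi t| <= k * `|s - t|)%R -> Lip u -> Lip (phi \o u).
Proof.
move=> k0 phik [K uK]; exists (k * K)%R => x y /=.
by rewrite (le_trans (phik _ _))// -mulrA ler_wpM2l.
Qed.

Lemma LipM (u v : X -> R) (M N : R) : Lip u -> Lip v ->
  (forall x, `|u x| <= M)%R -> (forall x, `|v x| <= N)%R -> Lip (fun x => u x * v x)%R.
Proof.
move=> /LipP[K K0 uK] /LipP[K' K'0 vK] uM vN; exists (M * K' + N * K)%R => x y.
have -> : (u x * v x - u y * v y = u x * (v x - v y) + v y * (u x - u y))%R by ring.
rewrite (le_trans (ler_normD _ _))// mulrDl !normrM -!mulrA.
by rewrite lerD// ler_pM.
Qed.

(** Equals 1 up to distance (k - 1) rho from [x] and 0 from distance k rho on. *)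
Definition bump (x : X) (k rho : R) (y : X) : R := clamp 0 1 (k - mdist x y / rho).

Lemma bump_itv x k rho y : (0 <= bump x k rho y <= 1)%R.
Proof. exact: clamp_itv. Qed.

Lemma bump_eq1 x k rho y : (0 < rho)%R -> (mdist x y <= (k - 1) * rho)%R ->
  bump x k rho y = 1%R.
Proof.
move=> rho0; rewrite -ler_pdivrMr// => H; rewrite /bump /clamp min_l ?max_r//.
by rewrite lerBrDr addrC -lerBrDr.
Qed.

Lemma bump_eq0 x k rho y : (0 < rho)%R -> (k * rho <= mdist x y)%R ->
  bump x k rho y = 0%R.
Proof.
move=> rho0; rewrite -ler_pdivlMr// => H; rewrite /bump /clamp.
have kd : (k - mdist x y / rho <= 0)%R by rewrite subr_le0.
by rewrite min_r ?max_l// (le_trans kd).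
Qed.

Lemma mdist_lip (x y z : X) : (`|mdist x z - mdist x y| <= mdist y z :> R)%R.
Proof.
have h1 := metric_triangle x y z; have := metric_triangle x z y.
rewrite (metric_sym z y) => h2; rewrite ler_norml; apply/andP; split; lra.
Qed.

Lemma bump_lip x k rho y z : (0 < rho)%R ->
  (`|bump x k rho y - bump x k rho z| <= rho^-1 * mdist y z)%R.
Proof.
move=> rho0; rewrite (le_trans (clamp_lip 0 1 _ _))//.
have -> : (k - mdist x y / rho - (k - mdist x z / rho) =
  rho^-1 * (mdist x z - mdist x y))%R by ring.
rewrite normrM gtr0_norm ?invr_gt0// ler_pM2l ?invr_gt0//.
exact: mdist_lip.
Qed.

Lemma Lip_bump x k rho : (0 < rho)%R -> Lip (bump x k rho).
Proof. by move=> rho0; exists rho^-1%R => y z; exact: bump_lip. Qed.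

Lemma norm_bump x k rho y : (`|bump x k rho y| <= 1)%R.
Proof. by have /andP[b0 b1] := bump_itv x k rho y; rewrite ger0_norm. Qed.

Lemma sub_ball_same (x : X) (r s : R) : (r <= s)%R -> ball x r `<=` ball x s.
Proof. by move=> rs; apply: sub_ball; rewrite mdistxx add0r. Qed.

Lemma closure_ball_le (x y : X) (r : R) : closure (ball x r) y -> (mdist x y <= r)%R.
Proof.
move=> yB; apply/ler_addgt0Pr => e e0.
have [z [/ballP xz /ballP yz]] := yB _ (nbhsx_ballx y e e0).
rewrite (le_trans (metric_triangle x z y))// lerD ?(ltW xz)//.
by rewrite metric_sym ltW.
Qed.

(** * Capacity of balls *)

Section poincare_consequences.
Variables (p tau CD CP : R).
Hypotheses (p1 : (1 < p)%R) (tau1 : (1 <= tau)%R).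
Hypotheses (CD1 : (1 <= CD)%R)
  (doublingE : forall (x : X) (r : R), (0 < r)%R ->
      mu (ball x (2 * r)%R) <= CD%:E * mu (ball x r)).
Hypotheses (CP0 : (0 < CP)%R)
  (poincareE : forall (x : X) (r : R) u g, (0 < r)%R -> Lip u ->
    upper_gradient u g -> exists m : R,
    \int[mu]_(y in ball x r) (`|u y - m| `^ p)%:E <=
    (CP * r `^ p)%:E * \int[mu]_(y in ball x (tau * r)) (g y `^ p)).

Let p0 : (0 < p)%R := lt_trans ltr01 p1.

Lemma ball_mass_doubling x r : (0 < r)%R ->
  (ball_mass x (2 * r) <= CD * ball_mass x r)%R.
Proof.
by move=> r0; rewrite -lee_fin EFinM -!ball_massE ?mulr_gt0//; exact: doublingE.
Qed.

Lemma ball_mass_doublingX n x r : (0 < r)%R ->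
  (ball_mass x (2 ^+ n * r) <= CD ^+ n * ball_mass x r)%R.
Proof.
move=> r0; elim: n => [|n ih]; first by rewrite !expr0 !mul1r.
rewrite !exprS -mulrA (le_trans (ball_mass_doubling _ _)) ?mulr_gt0 ?exprn_gt0//.
by rewrite -mulrA ler_wpM2l// (le_trans ler01).
Qed.

Lemma oscillation_ge x r y s (u : X -> R) (m : R) : (0 < s)%R ->
  ball y s `<=` ball x r -> (forall z, ball y s z -> (2^-1 <= `|u z - m|)%R) ->
  (2^-1 `^ p * ball_mass y s)%:E <= \int[mu]_(z in ball x r) (`|u z - m| `^ p)%:E.
Proof.
move=> s0 yx um; rewrite -(integral_const_ball y (2^-1 `^ p) s0).
apply: le_integral_set => //.
by move=> z yz; rewrite lee_fin ge0_ler_powR ?nnegrE ?um// ltW.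
Qed.

(** A Lipschitz function jumping from 0 to 1 between two balls has energy: its
    centring constant in the Poincare inequality is at distance at least 1/2
    from the value on one of them. *)
Lemma jump_energy x r y1 y2 s u g : (0 < r)%R -> (0 < s)%R -> Lip u -> upper_gradient u g ->
  ball y1 s `<=` ball x r -> ball y2 s `<=` ball x r ->
  (forall z, ball y1 s z -> (1 <= u z)%R) -> (forall z, ball y2 s z -> u z = 0%R) ->
  (Num.min (ball_mass y1 s) (ball_mass y2 s))%:E <=
  (2 `^ p * CP * r `^ p)%:E * \int[mu]_(z in ball x (tau * r)) (g z `^ p).
Proof.
move=> r0 s0 uLip ugu y1x y2x u1 u2; have [m PI] := poincareE x r0 uLip ugu.
have P0 : (0 < 2 `^ p :> R)%R by rewrite powR_gt0.
have half : (2 `^ p * 2^-1 `^ p = 1 :> R)%R.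
  by rewrite -powRM// divff// powR1.
set k := Num.min _ _; have -> : k = (2 `^ p * (2^-1 `^ p * k))%R.
  by rewrite mulrA half mul1r.
rewrite [in leLHS]EFinM -(mulrA _ CP) [in leRHS]EFinM -muleA lee_wpmul2l ?lee_fin ?powR_ge0//.
apply: le_trans PI; rewrite /k.
have [m2|m2] := leP 2^-1%R m.
  apply: (@le_trans _ _ (2^-1 `^ p * ball_mass y2 s)%:E).
    by rewrite lee_fin ler_wpM2l ?powR_ge0// ge_min lexx orbT.
  apply: oscillation_ge => // z /u2 ->.
  by rewrite sub0r normrN (le_trans m2)// ler_norm.
apply: (@le_trans _ _ (2^-1 `^ p * ball_mass y1 s)%:E).
  by rewrite lee_fin ler_wpM2l ?powR_ge0// ge_min lexx.
apply: oscillation_ge => // z /u1 uz.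
by rewrite (le_trans _ (ler_norm _))//; lra.
Qed.

(** If the annulus were empty, a cutoff function would jump from 1 to 0 across it.
    It would then be constant along short curves and have the upper gradient 0,
    against [jump_energy]. *)
Lemma annulus_nonempty (x : X) (rho : R) : (0 < rho)%R -> rho%:E < (8^-1)%:E * diam [set: X] ->
  exists y, (3 * rho <= mdist x y < 4 * rho)%R.
Proof.
move=> rho0 rhod; apply: contrapT => noy.
have gap y : (3 * rho <= mdist x y -> 4 * rho <= mdist x y)%R.
  by move=> xy; rewrite leNgt; apply/negP => xy4; apply: noy; exists y; rewrite xy.
have [z xz] : exists z, (4 * rho <= mdist x z)%R.
  apply: contrapT => noz.
  have dX : diam [set: X] <= (8 * rho)%:E.
    apply: ge_ereal_sup => _ [[y z] _ <-]; rewrite lee_fin.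
    have lt4 w : (mdist x w <= 4 * rho)%R.
      by rewrite leNgt; apply/negP => /ltW xw; apply: noz; exists w.
    rewrite (le_trans (metric_triangle y x z))// metric_sym.
    by have -> : (8 * rho = 4 * rho + 4 * rho)%R; [ring|rewrite lerD].
  have : rho%:E < (8^-1 * (8 * rho))%:E.
    by apply: lt_le_trans rhod _; rewrite EFinM lee_wpmul2l// lee_fin.
  by rewrite mulrA mulVf// mul1r ltxx.
pose u := bump x 4 rho.
have u01 y : u y = 1%R \/ u y = 0%R.
  have [xy|xy] := leP (mdist x y) (3 * rho)%R.
    by left; apply: bump_eq1 => //; rewrite (_ : 4 - 1 = 3)%R//; ring.
  by right; apply: bump_eq0 => //; exact/gap/ltW.
have ug0 : upper_gradient u (cst 0).
  apply: (@upper_gradient_local _ _ _ _ _ (rho / 2)) => //.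
  - by rewrite divr_gt0.
  - exact: measurable_cst.
  move=> c l m l0 lm mL ml.
  have : (`|u (arclength_param c l) - u (arclength_param c m)| <= 2^-1)%R.
    rewrite (le_trans (bump_lip _ _ _ _ rho0))// ler_pdivrMl//.
    rewrite (le_trans (arclength_param_lip _ (ltW lm) _))//.
  move=> H; apply: (@le_trans _ _ 0); last exact: integral_ge0.
  rewrite lee_fin; move: H; case: (u01 (arclength_param c l)) => ->;
    case: (u01 (arclength_param c m)) => ->; rewrite ?subrr ?subr0 ?sub0r ?normrN ?normr0 ?normr1//; lra.
have R0 : (0 < mdist x z + 4 * rho)%R by rewrite ltr_wpDl ?mdist_ge0// mulr_gt0.
have : (Num.min (ball_mass x rho) (ball_mass z rho))%:E <= 0.
  rewrite -[leRHS](mule0 (2 `^ p * CP * (mdist x z + 4 * rho) `^ p)%:E).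
  apply: le_trans (jump_energy R0 rho0 (Lip_bump x 4 rho0) ug0 _ _ _ _) _.
  - apply: sub_ball_same; rewrite (@le_trans _ _ (4 * rho)%R)// ?lerDr ?mdist_ge0//.
    by rewrite ler_peMl ?ltW// ltr1n.
  - by apply: sub_ball; rewrite lerD2l ler_peMl ?ltW// ltr1n.
  - move=> w /ballP xw; rewrite (bump_eq1 rho0)// (le_trans (ltW xw))//.
    by rewrite ler_peMl ?(ltW rho0)//; lra.
  - move=> w /ballP zw; apply: bump_eq0 => //; apply: gap.
    have := metric_triangle x w z; rewrite (metric_sym w); lra.
  rewrite le_eqVlt; apply/orP; left; apply/eqP; congr (_ * _).
  by under eq_integral do rewrite poweR0r ?gt_eqF//; rewrite integral0.
by rewrite lee_fin leNgt lt_min !ball_mass_gt0.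
Qed.

(** A function that is admissible for this capacity jumps between the ball of
    radius [rho] at [x] and a ball of the same radius centred in the annulus
    of [annulus_nonempty]. *)
Lemma capacity_ball_ge : exists2 K : R, (0 < K)%R & forall (x : X) (rho : R), (0 < rho)%R ->
  rho%:E < (8^-1)%:E * diam [set: X] ->
  (ball_mass x (2 * rho))%:E <= (K * rho `^ p)%:E *
    capacity mu p (closure (ball x rho)) (ball x (2 * rho)%R).
Proof.
have P0 : (0 < 2 `^ p :> R)%R by rewrite powR_gt0.
have CD0 : (0 < CD)%R := lt_le_trans ltr01 CD1.
pose K1 : R := (CD ^+ 3 * (2 `^ p * CP * 8 `^ p))%R.
have K10 : (0 < K1)%R by rewrite !mulr_gt0 ?exprn_gt0 ?powR_gt0.
exists (K1 * 2 `^ p)%R; first by rewrite mulr_gt0.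
move=> x rho rho0 rhod; have [y /andP[xy3 xy4]] := annulus_nonempty x rho0 rhod.
have rp0 : (0 < rho `^ p)%R by rewrite powR_gt0.
have KK0 : (0 < K1 * 2 `^ p * rho `^ p)%R by rewrite !mulr_gt0.
rewrite -lee_pdivrMl//; apply: le_ereal_inf_tmp => _ [u [g [[uLip u0] u1 wug ->]]].
rewrite lee_pdivrMl//; apply/lee_addgt0Pr => e e0.
have e'0 : (0 < e / (K1 * rho `^ p))%R by rewrite divr_gt0// mulr_gt0.
have [g' ug' g'le] := weak_upper_gradient_strong p0 wug e'0.
set Om := ball x (2 * rho) in u0 g'le *.
have ug'' := upper_gradient_restrict uLip ug'.
set g'' := g' \_ _ in ug''.
have [mg' g'0 _] := ug'; have [mg'' g''0 _] := ug''.
have r80 : (0 < 8 * rho)%R by rewrite mulr_gt0.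
have ballx : ball x rho `<=` ball x (8 * rho).
  by apply: sub_ball_same; rewrite ler_peMl ?ltW// ltr1n.
have bally : ball y rho `<=` ball x (8 * rho).
  by apply: sub_ball; lra.
have H : (Num.min (ball_mass x rho) (ball_mass y rho))%:E <=
   (2 `^ p * CP * (8 * rho) `^ p)%:E *
   ((2 `^ p)%:E * \int[mu]_(x in Om) (g x `^ p) + (e / (K1 * rho `^ p))%:E).
  apply: le_trans (jump_energy r80 rho0 uLip ug'' ballx bally _ _) _.
  - by move=> z xz; apply: u1; exact: subset_closure.
  - move=> z /ballP yz; apply: u0 => /ballP xz.
    have := metric_triangle x z y; rewrite (metric_sym z); lra.
  rewrite lee_wpmul2l ?lee_fin ?mulr_ge0 ?powR_ge0 ?(ltW CP0)//.
  have mOm : measurable Om by exact: measurable_ballX.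
  apply: le_trans (g'le Om mOm).
  apply: ge0_le_integral_sets => z; try exact: poweR_ge0.
    move=> _ _; rewrite /g'' patchE; case: ifP => // _.
    by rewrite poweR0r ?gt_eqF// poweR_ge0.
  move=> _ zO; rewrite /g'' patchE; case: ifP; last by rewrite poweR0r ?gt_eqF.
  by rewrite inE/= u0 ?eqxx.
have massle : (ball_mass x (2 * rho) <= CD ^+ 3 *
    Num.min (ball_mass x rho) (ball_mass y rho))%R.
  rewrite minr_pMr ?exprn_ge0 ?(ltW CD0)// le_min; apply/andP; split.
    rewrite (le_trans (ball_mass_doubling x rho0))// ler_wpM2r ?(ltW (ball_mass_gt0 _ _))//.
    by rewrite exprS ler_peMr ?exprn_ege1// ltW.
  apply: le_trans (ball_mass_doublingX 3 y rho0).
  apply: ball_mass_le; rewrite ?mulr_gt0 ?exprn_gt0//.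
  by apply: sub_ball; rewrite metric_sym; lra.
apply: (@le_trans _ _ (CD ^+ 3 * Num.min (ball_mass x rho) (ball_mass y rho))%:E).
  by rewrite lee_fin.
rewrite EFinM; apply: le_trans (lee_wpmul2l _ H) _.
  by rewrite lee_fin exprn_ge0// ltW.
rewrite muleA -EFinM powRM ?(ltW rho0)//.
have -> : (CD ^+ 3 * (2 `^ p * CP * (8 `^ p * rho `^ p)) = K1 * rho `^ p)%R.
  by rewrite /K1; ring.
have I0 : 0 <= \int[mu]_(x0 in Om) g x0 `^ p.
  by apply: integral_ge0 => z _; exact: poweR_ge0.
rewrite ge0_muleDr ?mule_ge0// ?lee_fin ?(ltW e'0) ?(ltW P0)//.
rewrite -[(K1 * rho `^ p)%:E * (e / _)%:E]EFinM (mulrC _ (e / _)%R).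
rewrite divfK ?gt_eqF ?mulr_gt0// leeD2r//.
by rewrite muleA -EFinM (mulrAC K1).
Qed.


(** * The Poincare inequality at the boundary *)

(** Let [m] be the centring constant of |u| on the ball of radius 2 rho. For
    m <= 0 there is nothing to do beyond the Poincare inequality. For m > 0 the
    function f0 = (1 - |u| / m)_+ is 1 on [E] and at most ||u| - m| / m, so that
    its product with a cutoff function has energy at most C m^-p int g^p. By
    fatness and [capacity_ball_ge] this bounds m^p times the mass of the ball. *)
Lemma boundary_poincare (E : set X) (c0 : R) : (0 < c0)%R ->
  (forall (x : X) (r : R), E x -> (0 < r)%R -> r%:E < (8^-1)%:E * diam [set: X] ->
      c0%:E * capacity mu p (closure (ball x r)) (ball x (2 * r)%R)
      <= capacity mu p (E `&` closure (ball x r)) (ball x (2 * r)%R)) ->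
  exists2 C : R, (0 < C)%R & forall (x : X) (rho : R) u g,
    E x -> (0 < rho)%R -> rho%:E < (8^-1)%:E * diam [set: X] ->
    Lip u -> (forall y, E y -> u y = 0%R) -> upper_gradient u g ->
    \int[mu]_(y in ball x (2 * rho)) (`|u y| `^ p)%:E <=
    (C * rho `^ p)%:E * \int[mu]_(y in ball x (tau * (2 * rho))) (g y `^ p).
Proof.
move=> c00 fat; have [K K0 capK] := capacity_ball_ge.
have P0 : (0 < 2 `^ p :> R)%R by rewrite powR_gt0.
pose C1 : R := (CP * 2 `^ p)%R.
pose C2 : R := (2 `^ p * (3 `^ p + C1))%R.
have C10 : (0 < C1)%R by rewrite mulr_gt0.
have C20 : (0 < C2)%R by rewrite mulr_gt0// addr_gt0// powR_gt0.
have Kc0 : (0 < K / c0 * C2)%R by rewrite mulr_gt0// divr_gt0.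
exists (2 `^ p * (C1 + K / c0 * C2))%R; first by rewrite mulr_gt0// addr_gt0.
move=> x rho u g Ex rho0 rhod uLip uE ugu.
have rho20 : (0 < 2 * rho)%R by rewrite mulr_gt0.
have rp0 : (0 < rho `^ p)%R by rewrite powR_gt0.
pose v y : R := `|u y|%R.
have norm1 (s t : R) : (`| `|s| - `|t| | <= 1 * `|s - t|)%R.
  by rewrite mul1r ler_dist_dist.
have vLip : Lip v := Lip_comp ler01 norm1 uLip.
have ugv : upper_gradient v g.
  have [mg g0 _] := ugu; apply: le_upper_gradient (upper_gradient_comp ler01 norm1 ugu) mg _.
  by move=> y; rewrite mul1e.
have [mg g0 _] := ugv.
have [m PI] := poincareE x rho20 vLip ugv.
set A := \int[mu]_(y in _) _ in PI; set I := \int[mu]_(y in ball x (tau * _)) _ in PI *.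
have I0 : 0 <= I by apply: integral_ge0 => y _; exact: poweR_ge0.
have {}PI : A <= (C1 * rho `^ p)%:E * I.
  by move: PI; rewrite powRM ?(ltW rho0)// mulrA.
set Om := ball x (2 * rho).
have [m0|m0] := leP m 0%R.
  apply: (@le_trans _ _ A).
    apply: le_integral_set => //.
    move=> y _; rewrite lee_fin ge0_ler_powR ?nnegrE//; first exact: ltW.
    by apply: le_trans (ler_norm _); rewrite /v lerBrDr gerDl.
  apply: le_trans PI _; rewrite lee_wpmul2r// lee_fin ler_wpM2r ?(ltW rp0)//.
  rewrite (@le_trans _ _ (1 * (C1 + K / c0 * C2))%R)//.
    by rewrite mul1r lerDl ltW.
  have C12 : (0 <= C1 + K / c0 * C2)%R by rewrite addr_ge0// ltW.
  by rewrite ler_wpM2r// -[leLHS](powRr0 2) ler_powR ?ler1n// ltW.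
have mi0 : (0 < m^-1)%R by rewrite invr_gt0.
pose phi (s : R) : R := clamp 0 1 (1 - s / m).
have phi_lip s t : (`|phi s - phi t| <= m^-1 * `|s - t|)%R.
  rewrite (le_trans (clamp_lip 0 1 _ _))//.
  have -> : (1 - s / m - (1 - t / m) = m^-1 * (t - s))%R by ring.
  by rewrite normrM gtr0_norm// distrC.
pose f0 := phi \o v.
have f0Lip : Lip f0 := Lip_comp (ltW mi0) phi_lip vLip.
have ugf0 : upper_gradient f0 (fun y => (m^-1)%:E * g y).
  exact: upper_gradient_comp (ltW mi0) phi_lip ugv.
have f0_itv y : (0 <= f0 y <= 1)%R by exact: clamp_itv.
have f0_norm y : (`|f0 y| <= 1)%R.
  by have /andP[h0 h1] := f0_itv y; rewrite ger0_norm.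
have f0_le y : (`|f0 y| <= m^-1 * `|v y - m|)%R.
  have /andP[h0 h1] := f0_itv y; rewrite ger0_norm// /f0/= /phi /clamp.
  have -> : (1 - v y / m = m^-1 * (m - v y))%R by field; rewrite gt_eqF.
  rewrite ge_max ge_min mulr_ge0 ?(ltW mi0)//=; apply/orP; right.
  by rewrite ler_pM2l// distrC ler_norm.
pose psi := bump x 2 rho.
pose f y : R := (f0 y * psi y)%R.
have fLip : Lip f.
  exact: LipM f0Lip (Lip_bump x 2 rho0) f0_norm (@norm_bump x 2 rho).
pose G y : \bar R := (3 * 1)%:E * ((m^-1)%:E * g y) + (rho^-1 * `|f0 y|)%:E.
have ugf : upper_gradient f G.
  apply: (upper_gradientM (e := 1%R)) ugf0 => //.
  - exact: Lip_borel.
  - exact: measurable_cst.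
  - exact: measurable_cst.
  - by move=> y; rewrite invr_ge0 ltW.
  - by move=> y z _; exact: norm_bump.
  - by move=> y z z' _ _; exact: bump_lip.
have capG : capacity mu p (E `&` closure (ball x rho)) Om <= \int[mu]_(y in Om) (G y `^ p).
  apply: ereal_inf_lbound; exists f, G; split => //.
  - split => // y yO; rewrite /f /psi bump_eq0 ?mulr0// leNgt; apply/negP => xy.
    by apply: yO; apply/ballP.
  - move=> y [Ey yB]; rewrite /f /psi bump_eq1//.
      by rewrite /f0/= /v uE// normr0 /phi mul0r subr0 /clamp minxx max_r// mulr1.
    by rewrite (_ : (2 - 1) * rho = rho)%R; [exact: closure_ball_le|ring].
  - exact: upper_gradient_weak.
have GI : \int[mu]_(y in Om) (G y `^ p) <= (C2 * m^-1 `^ p)%:E * I.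
  pose h y : \bar R := (2 `^ p * m^-1 `^ p)%:E * ((3 `^ p)%:E * g y `^ p +
    (rho `^ p)^-1%:E * (`|v y - m| `^ p)%:E).
  have mv : borel_fun (fun y => (`|v y - m| `^ p)%:E).
    apply: (borel_powR p (u := fun z => v z - m)%R); apply: Lip_borel.
    exact: LipD_const.
  have mOm : measurable Om by exact: measurable_ballX.
  have bm k : borel_fun k -> measurable_fun Om k.
    by move=> /borel_fun_measurable mk; exact: measurable_funS mk.
  have kg0 y : 0 <= (3 `^ p)%:E * g y `^ p.
    by rewrite mule_ge0 ?lee_fin ?powR_ge0 ?poweR_ge0.
  have kv0 y : 0 <= (rho `^ p)^-1%:E * (`|v y - m| `^ p)%:E.
    by rewrite mule_ge0 ?lee_fin ?invr_ge0 ?powR_ge0.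
  apply: (@le_trans _ _ (\int[mu]_(y in Om) h y)).
    apply: le_integral_set => //.
    - by move=> y; exact: poweR_ge0.
    - move=> y; apply: mule_ge0; last exact: adde_ge0.
      by rewrite lee_fin mulr_ge0// powR_ge0.
    - move=> y _; rewrite /G /h mulr1.
      have h1 : 0 <= (m^-1)%:E * g y by rewrite mule_ge0// lee_fin ltW.
      apply: le_trans (poweRD_le _ _ _) _; rewrite ?(ltW p0)//.
      + by rewrite mule_ge0.
      + by rewrite lee_fin mulr_ge0// invr_ge0 ltW.
      rewrite (EFinM (2 `^ p)) -muleA lee_wpmul2l ?lee_fin ?(ltW P0)//.
      rewrite ge0_muleDr//.
      apply: leeD.
        rewrite poweR_EFinM// poweR_EFinM ?(ltW mi0)// muleCA//.
      rewrite poweR_EFin -!EFinM lee_fin mulrCA.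
      rewrite powRM ?invr_ge0 ?(ltW rho0)// -powR_inv1 ?(ltW rho0)//.
      rewrite -powRrM mulN1r powRN ler_wpM2l ?invr_ge0 ?(ltW rp0)//.
      rewrite -powRM ?(ltW mi0)// ge0_ler_powR ?nnegrE ?(ltW p0)//.
      by rewrite mulr_ge0// ltW.
  have mgp := borel_poweR p mg.
  have mkg : measurable_fun Om (fun y => (3 `^ p)%:E * g y `^ p).
    by apply: measurable_funeM; exact: bm.
  have mkv : measurable_fun Om (fun y => (rho `^ p)^-1%:E * (`|v y - m| `^ p)%:E).
    by apply: measurable_funeM; exact: bm.
  rewrite /h ge0_integralZl_EFin ?mulr_ge0 ?powR_ge0//; last 2 first.
  - by move=> y _; rewrite adde_ge0.
  - exact: emeasurable_funD.
  rewrite ge0_integralD//.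
  rewrite ge0_integralZl_EFin ?powR_ge0//; [|by move=> y _; exact: poweR_ge0|exact: bm].
  rewrite ge0_integralZl_EFin ?invr_ge0 ?powR_ge0//; [|exact: bm].
  have gI : \int[mu]_(y in Om) (g y `^ p) <= I.
    apply: le_integral_set => //; try by move=> y; exact: poweR_ge0.
    by apply: sub_ball_same; rewrite ler_peMl// ltW.
  rewrite -/A [X in _ <= X%:E * _](_ : _ =
    2 `^ p * m^-1 `^ p * (3 `^ p + (rho `^ p)^-1 * (C1 * rho `^ p)))%R; last first.
    by rewrite /C2; field; rewrite gt_eqF.
  rewrite [in leRHS]EFinM -muleA lee_wpmul2l ?lee_fin ?mulr_ge0 ?powR_ge0//.
  rewrite EFinD ge0_muleDl ?lee_fin ?powR_ge0//; last first.
    by rewrite mulr_ge0 ?invr_ge0 ?powR_ge0// mulr_ge0 ?powR_ge0// ltW.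
  rewrite leeD//; first by rewrite lee_wpmul2l// lee_fin powR_ge0.
  by rewrite EFinM -muleA lee_wpmul2l// lee_fin invr_ge0 powR_ge0.
have Mle : (m `^ p * ball_mass x (2 * rho))%:E <= (K / c0 * C2 * rho `^ p)%:E * I.
  have := le_trans (fat x rho Ex rho0 rhod) (le_trans capG GI).
  rewrite -lee_pdivlMl// => /(lee_wpmul2l _) H.
  have {}H := le_trans (capK x rho rho0 rhod) (H (K * rho `^ p)%:E _).
  have mp0 : (0 < m `^ p)%R by rewrite powR_gt0.
  rewrite EFinM; apply: le_trans (lee_wpmul2l _ (H _)) _.
  - by rewrite lee_fin ltW.
  - by rewrite lee_fin mulr_ge0 ?ltW.
  rewrite !muleA -!EFinM lee_wpmul2r// lee_fin le_eqVlt; apply/orP; left; apply/eqP.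
  rewrite -powR_inv1 ?(ltW m0)// -powRrM mulN1r powRN; field.
  by rewrite !gt_eqF.
apply: (@le_trans _ _ (\int[mu]_(y in Om) ((2 `^ p)%:E *
    ((`|v y - m| `^ p)%:E + (m `^ p)%:E)))).
  apply: le_integral_set => //.
    by move=> y; rewrite mule_ge0 ?adde_ge0 ?lee_fin ?powR_ge0.
  move=> y _; rewrite -!poweR_EFin; apply: le_trans (poweRD_le _ _ _) => //; [|exact: ltW..].
  apply: le_poweR => //; first exact: ltW.
  rewrite -EFinD lee_fin -{1}(normr_id (u y)) -/(v y) -[X in (_ <= _ + X)%R]ger0_norm ?(ltW m0)//.
  by rewrite -{1}(subrK m (v y)) ler_normD.
have mOm : measurable Om by exact: measurable_ballX.
have mvO : measurable_fun Om (fun y => (`|v y - m| `^ p)%:E).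
  apply: (@measurable_funS _ _ _ _ setT) => //; apply: borel_fun_measurable.
  apply: (borel_powR p (u := fun z => v z - m)%R); apply: Lip_borel.
  exact: LipD_const.
rewrite ge0_integralZl_EFin ?powR_ge0//; last 2 first.
- by move=> y _; rewrite adde_ge0// lee_fin powR_ge0.
- exact: emeasurable_funD.
rewrite ge0_integralD//; last by move=> y _; rewrite lee_fin powR_ge0.
rewrite integral_const_ball// -/A.
rewrite -(mulrA (2 `^ p)%R) [in leRHS]EFinM -muleA lee_wpmul2l ?lee_fin ?powR_ge0//.
have ? : (0 <= C1 * rho `^ p)%R by rewrite mulr_ge0 ?(ltW C10)// ltW.
have ? : (0 <= K / c0 * C2 * rho `^ p)%R by rewrite mulr_ge0 ?(ltW Kc0)// ltW.
rewrite (mulrDl C1) (EFinD (C1 * _)) ge0_muleDl ?lee_fin//.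
by rewrite leeD.
Qed.


(** * Separated sets and the distance to a set *)

Definition separated (t : R) (s : seq X) : bool := pairwise (fun y z => t <= mdist y z)%R s.

(** The balls of radius t / 2 at the points are disjoint and lie in the ball of
    radius r + t / 2 at [x], of whose mass each carries at least the fraction
    CD^-n by doubling. *)
Lemma separated_size (t r : R) (x : X) (s : seq X) (n : nat) : (0 < t)%R -> (0 < r)%R ->
  separated t s -> (forall y, y \in s -> (mdist x y < r)%R) ->
  (4 * r + t <= 2 ^+ n * t)%R -> ((size s)%:R <= CD ^+ n)%R.
Proof.
move=> t0 r0 st sr rn; have t20 : (0 < t / 2)%R by rewrite divr_gt0.
have CD0 : (0 < CD)%R := lt_le_trans ltr01 CD1.
have rt0 : (0 < r + t / 2)%R by rewrite addr_gt0.
pose M := ball_mass x (r + t / 2)%R.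
have M0 : (0 < M)%R by exact: ball_mass_gt0.
pose U (l : seq X) := \big[setU/set0]_(y <- l) ball y (t / 2).
have mU l : measurable (U l).
  by apply: bigsetU_measurable => y _; exact: measurable_ballX.
have sumU l : separated t l -> mu (U l) = (\sum_(y <- l) ball_mass y (t / 2))%:E.
  elim: l => [_|y l ih]; first by rewrite /U !big_nil measure0.
  rewrite /separated/= => /andP[yl ll]; rewrite /U !big_cons EFinD -ih// -ball_massE//.
  apply: measureU; [exact: measurable_ballX|exact: (mU l)|].
  apply/seteqP; split => // z [/ballP yz].
  rewrite -bigcup_seq => -[w /= wl /ballP wz].
  move/allP : yl => /(_ _ wl); have := metric_triangle y z w.
  rewrite (metric_sym z w); lra.
have Ux : U s `<=` ball x (r + t / 2).
  rewrite /U -bigcup_seq => z [y /= ys /ballP yz]; apply/ballP.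
  have := metric_triangle x y z; have := sr _ ys; lra.
have : (\sum_(y <- s) ball_mass y (t / 2) <= M)%R.
  rewrite -lee_fin -sumU// -ball_massE//.
  by apply: le_measure => //; rewrite inE//; exact: measurable_ballX.
have : ((size s)%:R * (M / CD ^+ n) <= \sum_(y <- s) ball_mass y (t / 2))%R.
  have -> : ((size s)%:R * (M / CD ^+ n) = \sum_(y <- s) (M / CD ^+ n))%R.
    by rewrite big_const_seq count_predT iter_addr_0 mulr_natl.
  rewrite !big_seq; apply: ler_sum => y ys.
  rewrite ler_pdivrMr ?exprn_gt0// mulrC.
  apply: le_trans (ball_mass_doublingX n y t20).
  apply: ball_mass_le; rewrite ?mulr_gt0 ?exprn_gt0//.
  apply: sub_ball; rewrite metric_sym; have := sr _ ys; lra.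
move=> /le_trans /[apply].
by rewrite mulrA ler_pdivrMr ?exprn_gt0// mulrC ler_pM2l.
Qed.

Lemma exp2_ge (k : R) : exists n : nat, (k <= 2 ^+ n)%R.
Proof.
exists (Num.truncn k).+1; have := Num.Theory.truncnS_gt k => /ltW /le_trans; apply.
by rewrite -natrX ler_nat ltnW// ltn_expl.
Qed.

(** A maximal separated set is finite, because [mu] is doubling. *)
Lemma separated_net (A : set X) (x : X) (r t : R) : (0 < t)%R -> (0 < r)%R ->
  A `<=` ball x r -> exists s, [/\ separated t s, (forall y, y \in s -> A y) &
    forall y, A y -> exists2 z, z \in s & (mdist y z < t)%R].
Proof.
move=> t0 r0 Ax; have [n rn] := exp2_ge ((4 * r + t) / t).
rewrite ler_pdivrMr// in rn; apply: contrapT => nonet.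
have H k : exists s, [/\ separated t s, (forall y, y \in s -> A y) & size s = k].
  elim: k => [|k [s [ss sA sk]]]; first by exists [::].
  apply: contrapT => nos; apply: nonet; exists s; split => // y Ay.
  apply: contrapT => noz; apply: nos; exists (y :: s); split.
  - rewrite /separated/=; apply/andP; split => //; apply/allP => z zs.
    by rewrite leNgt; apply/negP => yz; apply: noz; exists z.
  - by move=> z; rewrite inE => /predU1P[->//|]; exact: sA.
  - by rewrite /= sk.
have [s [ss sA sk]] := H (Num.truncn (CD ^+ n)).+1.
have := separated_size t0 r0 ss (fun y ys => (ballP _ _ _).1 (Ax _ (sA _ ys))) rn.
by rewrite sk leNgt Num.Theory.truncnS_gt.
Qed.

Section distance_to_set.
Variables (E : set X) (E0 : E !=set0).

(** Real-valued form of [edist_inf]. *)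
Definition dist_set (y : X) : R := inf (@mdist R X y @` E).

Let lbE y : has_lbound (@mdist R X y @` E).
Proof. by exists 0%R => _ [x _ <-]; exact: mdist_ge0. Qed.

Let neE y : (@mdist R X y @` E) !=set0.
Proof. by have [x Ex] := E0; exists (mdist y x), x. Qed.

Lemma dist_set_ge0 y : (0 <= dist_set y)%R.
Proof. by apply: lb_le_inf (neE y) _ => _ [x _ <-]; exact: mdist_ge0. Qed.

Lemma dist_set_le y x : E x -> (dist_set y <= mdist y x)%R.
Proof. by move=> Ex; apply: (ge_inf (lbE y)); exists x. Qed.

Lemma dist_set_lt y t : (dist_set y < t)%R -> exists2 x, E x & (mdist y x < t)%R.
Proof.
move=> yt; have yt0 : (0 < t - dist_set y)%R by rewrite subr_gt0.
have [_ [x Ex <-]] := inf_adherent yt0 (conj (neE y) (lbE y)).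
by rewrite addrC subrK; exists x.
Qed.

Lemma dist_set_lip y z : (`|dist_set y - dist_set z| <= mdist y z)%R.
Proof.
have H a b : (dist_set a <= mdist a b + dist_set b)%R.
  rewrite -lerBlDl; apply: lb_le_inf (neE b) _ => _ [x Ex <-].
  by rewrite lerBlDl (le_trans (dist_set_le a Ex))// metric_triangle.
by rewrite ler_norml lerBlDr H andbT lerBrDr addrC lerBlDl metric_sym H.
Qed.

Lemma Lip_dist_set : Lip dist_set.
Proof. by exists 1%R => y z; rewrite mul1r; exact: dist_set_lip. Qed.

Lemma borel_dist_set_lt t : borel_set [set y | dist_set y < t]%R.
Proof.
apply: sub_sigma_algebra; have /continuousP := Lip_continuous Lip_dist_set.
by move=> /(_ [set s | s < t]%R); apply; exact: open_lt.
Qed.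

Lemma dist_set0 y : closed E -> dist_set y = 0%R -> E y.
Proof.
move=> cE y0; rewrite (closure_id E).1// => B /nbhs_ballP[e /= e0 yB].
have [x Ex yx] : exists2 x, E x & (mdist y x < e)%R by apply: dist_set_lt; rewrite y0.
by exists x; split => //; apply: yB; apply/ballP.
Qed.

Lemma edist_inf_dist_set y : edist_inf E y = (dist_set y)%:E.
Proof.
have edE x : edist (y, x) = (mdist y x)%:E.
  apply/eqP; rewrite eq_le; apply/andP; split.
    apply/lee_addgt0Pr => e e0; apply: ereal_inf_lbound.
    exists (mdist y x + e)%R => //; split => /=; first by rewrite ltr_wpDl ?mdist_ge0.
    by apply/ballP; rewrite ltrDl.
  apply: le_ereal_inf_tmp => _ [r [/= r0 /ballP yx] <-].
  by rewrite lee_fin ltW.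
apply/eqP; rewrite eq_le; apply/andP; split.
  apply/lee_addgt0Pr => e e0.
  have [x Ex yx] : exists2 x, E x & (mdist y x < dist_set y + e)%R.
    by apply: dist_set_lt; rewrite ltrDl.
  apply: (@le_trans _ _ (edist (y, x))); first by apply: ereal_inf_lbound; exists x.
  by rewrite edE -EFinD lee_fin ltW.
apply: le_ereal_inf_tmp => _ [x Ex <-].
by rewrite edE lee_fin dist_set_le.
Qed.

End distance_to_set.

(** * Strips around the set *)

Section hardy.
Variables (E : set X) (CB : R).
Hypotheses (E_closed : closed E) (CB0 : (0 < CB)%R).
Hypothesis boundaryE : forall (x : X) (rho : R) u g,
  E x -> (0 < rho)%R -> rho%:E < (8^-1)%:E * diam [set: X] ->
  Lip u -> (forall y, E y -> u y = 0%R) -> upper_gradient u g ->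
  \int[mu]_(y in ball x (2 * rho)) (`|u y| `^ p)%:E <=
  (CB * rho `^ p)%:E * \int[mu]_(y in ball x (tau * (2 * rho))) (g y `^ p).

Local Notation dE := (dist_set E).

Lemma sum_indicator_le (s : seq X) (P : pred X) (a : \bar R) (N : R) : 0 <= a ->
  ((size [seq z <- s | P z])%:R <= N)%R ->
  \sum_(z <- s) (if P z then a else 0) <= N%:E * a.
Proof.
move=> a0 sN; apply: (@le_trans _ _ ((size [seq z <- s | P z])%:R%:E * a)).
  elim: s {sN} => [|z s ih]; first by rewrite big_nil mul0e.
  rewrite big_cons /=; case: (P z); last by rewrite add0e.
  rewrite /= -natr1 EFinD ge0_muleDl ?lee_fin ?ler0n// mul1e addeC.
  by rewrite leeD2r.
by rewrite lee_wpmul2r// lee_fin.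
Qed.

(** The balls of radius 2 t at the points of a maximal t-separated subset of [E]
    cover the strip, and their dilates overlap boundedly often. *)
Lemma strip_estimate : exists2 C : R, (0 < C)%R &
  forall (w : X) (T t : R) v g, E w -> (0 < t)%R -> (t <= T)%R ->
    T%:E < (8^-1)%:E * diam [set: X] -> Lip v ->
    (forall y, E y -> v y = 0%R) -> upper_gradient v g ->
    \int[mu]_(y in [set y | ball w T y /\ dE y < t]%R) (`|v y| `^ p)%:E <=
    (C * t `^ p)%:E * \int[mu]_(y in [set y | dE y < tau * (2 * t)]%R) (g y `^ p).
Proof.
have CD0 : (0 < CD)%R := lt_le_trans ltr01 CD1.
have tau0 : (0 < tau)%R := lt_le_trans ltr01 tau1.
have [n nt] := exp2_ge (4 * (tau * 2) + 1).
exists (CB * CD ^+ n)%R; first by rewrite mulr_gt0// exprn_gt0.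
move=> w T t v g Ew t0 tT Td vLip vE ugv; have [mg g0 _] := ugv.
have E0 : E !=set0 by exists w.
have T0 : (0 < T)%R := lt_le_trans t0 tT.
have tp0 : (0 < t `^ p)%R by rewrite powR_gt0.
have T20 : (0 < 2 * T)%R by rewrite mulr_gt0.
have [s [ss sE sA]] := separated_net t0 T20 (@subIsetr _ E (ball w (2 * T)%R)).
set S := [set y | _ /\ _]; set D := [set y | _].
pose f y : \bar R := (`|v y| `^ p)%:E; pose h y : \bar R := g y `^ p.
have f0 y : 0 <= f y by rewrite lee_fin powR_ge0.
have h0 y : 0 <= h y by exact: poweR_ge0.
have bf : borel_fun f by apply: borel_powR; exact: Lip_borel.
have bh : borel_fun h by exact: borel_poweR.
have mres (k : X -> \bar R) (z : X) (r : R) : borel_fun k -> measurable_fun [set: X] (k \_ (ball z r : set X)).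
  by move=> bk; apply: borel_fun_measurable; apply: borel_restrict => //; exact: ball_borel.
have res0 (k : X -> \bar R) (z : X) (r : R) y : (forall y, 0 <= k y) -> 0 <= (k \_ (ball z r : set X)) y.
  by move=> k0; rewrite patchE; case: ifP.
apply: (@le_trans _ _ (\sum_(z <- s) \int[mu]_(y in ball z (2 * t)) f y)).
  under eq_bigr do rewrite integral_mkcond.
  rewrite -ge0_integral_sum//; [|by move=> z; exact: mres|by move=> z y _; exact: res0].
  apply: le_integral_set => //; first by move=> y; apply: sume_ge0 => z _; exact: res0.
  move=> y [/ballP wy] /(dist_set_lt E0)[x Ex yx].
  have [|z zs xz] := sA x.
    split => //; apply/ballP; have := metric_triangle w y x; lra.
  have yz : ball z (2 * t) y.
    apply/ballP; have := metric_triangle y x z; rewrite (metric_sym z); lra.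
  rewrite (big_rem z zs)/= patchE mem_set// leeDl// sume_ge0// => z' _.
  exact: res0.
apply: (@le_trans _ _ (\sum_(z <- s) (CB * t `^ p)%:E *
    \int[mu]_(y in ball z (tau * (2 * t))) h y)).
  rewrite !big_seq; apply: lee_sum => z /sE[Ez _]; apply: boundaryE => //.
  by apply: le_lt_trans Td; rewrite lee_fin.
have hsum0 : 0 <= \sum_(z <- s) \int[mu]_(y in ball z (tau * (2 * t))) h y.
  by apply: sume_ge0 => z _; exact: integral_ge0.
rewrite -ge0_sume_distrr; last by move=> z _; exact: integral_ge0.
have Ctp0 : (0 <= CB * t `^ p)%R by rewrite mulr_ge0// ltW.
rewrite (mulrAC CB) (EFinM (CB * t `^ p)) -muleA lee_wpmul2l ?lee_fin//.
under eq_bigr do rewrite integral_mkcond.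
rewrite -ge0_integral_sum//; [|by move=> z; exact: mres|by move=> z y _; exact: res0].
have mD : measurable D.
  exact: borel_measurable (borel_dist_set_lt E0 _).
have CDn : (0 <= CD ^+ n)%R by rewrite exprn_ge0// ltW.
rewrite -ge0_integralZl_EFin//; [|by move=> y _; exact: h0|
  by apply: measurable_funS (borel_fun_measurable bh)].
apply: ge0_le_integral_sets => //.
- by move=> y; apply: sume_ge0 => z _; exact: res0.
- by move=> y; rewrite mule_ge0//; exact: h0.
- move=> y _ _; under eq_bigr do rewrite patchE.
  apply: sum_indicator_le => //.
  apply: (@separated_size t (tau * (2 * t)) y) => //; rewrite ?mulr_gt0//.
  + apply: subseq_pairwise ss; exact: filter_subseq.
  + move=> z; rewrite mem_filter => /andP[/set_mem/ballP + _].
    by rewrite metric_sym.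
  + have -> : (4 * (tau * (2 * t)) + t = (4 * (tau * 2) + 1) * t)%R by ring.
    by rewrite ler_wpM2r// ltW.
- move=> y _ yD; rewrite big_seq big1// => z /sE[Ez _]; rewrite patchE.
  case: ifPn => // /set_mem/ballP zy; exfalso; apply: yD.
  rewrite /D/=; apply: le_lt_trans (dist_set_le y Ez) _.
  by rewrite metric_sym.
Qed.

(** * Summation over the strips *)

(** Mean value inequality for the power function, from
      x^a - y^a = x^a (1 - exp (- a ln (x / y))) <= x^a a ln (x / y)
    for y <= x. *)
Lemma powR_diff_le (a x y m M : R) : (0 <= a)%R -> (0 < m)%R ->
  (m <= x <= M)%R -> (m <= y <= M)%R ->
  (`|x `^ a - y `^ a| <= a * (M `^ a / m) * `|x - y|)%R.
Proof.
move=> a0 m0; wlog yx : x y / (y <= x)%R.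
  move=> H xm ym; have [|/ltW xy] := leP y x; first by move=> /H; exact.
  by rewrite distrC (distrC x) H.
move=> /andP[mx xM] /andP[my yM].
have x0 := lt_le_trans m0 mx; have y0 := lt_le_trans m0 my.
rewrite !ger0_norm ?subr_ge0 ?ge0_ler_powR ?nnegrE ?(ltW x0) ?(ltW y0)//.
have xa0 : (0 <= x `^ a)%R by exact: powR_ge0.
have yE : (y `^ a = x `^ a * expR (- (a * ln (x / y))))%R.
  rewrite /powR !gt_eqF// -expRD; congr expR.
  by rewrite ln_div ?posrE//; ring.
apply: (@le_trans _ _ (x `^ a * (a * ln (x / y)))%R).
  rewrite yE -{1}[(x `^ a)%R]mulr1 -mulrBr ler_wpM2l// lerBlDr addrC -lerBlDr.
  exact: expR_ge1Dx.
have lnxy : (ln (x / y) <= (x - y) / y)%R.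
  have -> : (x / y = 1 + (x - y) / y)%R by field; rewrite gt_eqF.
  by apply: le_ln1Dx; rewrite (lt_le_trans (ltrN10 R))// divr_ge0 ?subr_ge0// ltW.
rewrite mulrCA -mulrA ler_wpM2l//.
apply: (@le_trans _ _ (M `^ a * ((x - y) / m))%R); last by rewrite mulrAC mulrA.
apply: ler_pM => //; first by rewrite ln_ge0// ler_pdivlMr// mul1r.
  by rewrite ge0_ler_powR ?nnegrE ?(ltW x0)// (le_trans (ltW x0)).
rewrite (le_trans lnxy)// ler_wpM2l ?subr_ge0// lef_pV2 ?posrE//.
Qed.

(** Up to a factor a geometric sum is its last term, here in the presence of gaps. *)
Lemma geometric_sum_le (theta c B : R) (P : pred nat) (K : nat) : (1 < theta)%R ->
  (0 <= c)%R -> (0 <= B)%R ->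
  (forall k, (k < K)%N -> P k -> (c * theta ^+ k <= B)%R) ->
  (\sum_(0 <= k < K) (if P k then c * theta ^+ k else 0) <= theta / (theta - 1) * B)%R.
Proof.
move=> th1 c0 B0; have th0 : (0 < theta)%R := lt_trans ltr01 th1.
have th10 : (0 < theta - 1)%R by rewrite subr_gt0.
elim: K => [_|K ih PB].
  by rewrite big_geq// mulr_ge0// divr_ge0// ltW.
have [PK|nPK] := boolP (P K); last first.
  rewrite big_nat_recr//= (negbTE nPK) addr0 ih// => k kK; apply: PB.
  exact: ltnW.
apply: (@le_trans _ _ (theta / (theta - 1) * (c * theta ^+ K))%R); last first.
  by rewrite ler_wpM2l ?PB// divr_ge0// ltW.
apply: (@le_trans _ _ (\sum_(0 <= k < K.+1) c * theta ^+ k)%R).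
  by apply: ler_sum => k _; case: ifP => // _; rewrite mulr_ge0// exprn_ge0// ltW.
rewrite -mulr_sumr mulrCA ler_wpM2l// big_mkord mulrAC ler_pdivlMr// mulrC -subrX1.
by rewrite exprS gerDl lerN10.
Qed.

(** The constant of [geometric_sum_le] for the ratio 2^b grows no faster than 1 / b
    as b tends to 0. *)
Lemma two_powR_ratio (b : R) : (0 < b <= 1)%R ->
  (1 < 2 `^ b :> R)%R /\ (2 `^ b / (2 `^ b - 1) <= 4 / b)%R.
Proof.
move=> /andP[b0 b1].
have ln2 : (2^-1 <= ln 2 :> R)%R.
  have : (ln (1 + - 2^-1) <= - 2^-1 :> R)%R by apply: le_ln1Dx; lra.
  have -> : (1 + - 2^-1 = 2^-1 :> R)%R by field.
  by rewrite lnV ?posrE// lerN2.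
have tb : (b / 2 <= 2 `^ b - 1)%R.
  rewrite /powR gt_eqF// lerBrDl (le_trans _ (expR_ge1Dx _))// lerD2l ler_wpM2l//.
  exact: ltW.
have t2 : (2 `^ b <= 2 :> R)%R.
  by rewrite -[leRHS]powRr1// ler_powR// ler1n.
have b20 : (0 < b / 2)%R by rewrite divr_gt0.
have t10 : (0 < 2 `^ b - 1 :> R)%R := lt_le_trans b20 tb.
split; first by rewrite -subr_gt0.
have -> : (4 / b = 2 / (b / 2))%R by field; rewrite gt_eqF.
by rewrite ler_pM ?powR_ge0 ?invr_ge0 ?(ltW t10)// lef_pV2 ?posrE.
Qed.

(** The truncation keeps the distance away from 0 and bounded, so that all its
    powers are bounded and Lipschitz. *)
Definition trunc_dist (e T : R) (y : X) : R := clamp e T (dE y).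

Lemma trunc_dist_itv (e T : R) y : (0 < e <= T)%R -> (e <= trunc_dist e T y <= T)%R.
Proof.
by move=> /andP[_ eT]; exact: clamp_itv.
Qed.

Lemma trunc_dist_lip (e T : R) y z : E !=set0 ->
  (`|trunc_dist e T y - trunc_dist e T z| <= mdist y z)%R.
Proof. by move=> E0; exact: le_trans (clamp_lip _ _ _ _) (dist_set_lip E0 y z). Qed.

Lemma Lip_trunc_dist (e T : R) : E !=set0 -> Lip (trunc_dist e T).
Proof. by move=> E0; exists 1%R => y z; rewrite mul1r trunc_dist_lip. Qed.

Lemma ler_powRN (a x y : R) : (0 <= a)%R -> (0 < x)%R -> (x <= y)%R ->
  (y `^ (- a) <= x `^ (- a))%R.
Proof.
move=> a0 x0 xy; have y0 := lt_le_trans x0 xy.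
by rewrite !powRN lef_pV2 ?posrE ?powR_gt0// ge0_ler_powR ?nnegrE ?(ltW x0) ?(ltW y0).
Qed.

Lemma powRD_pos (x a b : R) : (0 < x)%R -> (x `^ (a + b) = x `^ a * x `^ b)%R.
Proof. by move=> x0; apply: powRD; rewrite (gt_eqF x0) implybT. Qed.

Lemma powRVN (x a : R) : (0 <= x)%R -> (x^-1 `^ (- a) = x `^ a)%R.
Proof.
by move=> x0; rewrite -powR_inv1// -powRrM mulrNN mul1r.
Qed.

Lemma powR_exprn (x a : R) (k : nat) : (0 <= x)%R -> ((x ^+ k) `^ a = (x `^ a) ^+ k)%R.
Proof. by move=> x0; rewrite -powR_mulrn// -powRrM mulrC powRrM powR_mulrn ?powR_ge0. Qed.

Lemma borel_powR_pos (u : X -> R) (a : R) : borel_fun (EFin \o u) ->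
  (forall y, 0 <= u y)%R -> borel_fun (fun y => (u y `^ a)%:E).
Proof.
move=> bu u0; have -> : (fun y => (u y `^ a)%:E) = (fun y => (`|u y| `^ a)%:E).
  by apply/funext => y; rewrite ger0_norm.
exact: borel_powR.
Qed.

(** Multiply the strip estimates at the scales t_k = T / 2^k by t_k^-(p + b) and
    sum. A point at distance d from [E] lies in a left-hand strip with t_k <= 2 d,
    while on the right it is seen only by the scales t_k > d / (2 tau), over which
    the sum of the t_k^-b is at most C d^-b / b. *)
Lemma weighted_hardy (CS : R) : (0 < CS)%R ->
  (forall (w : X) (T t : R) v g, E w -> (0 < t)%R -> (t <= T)%R ->
    T%:E < (8^-1)%:E * diam [set: X] -> Lip v ->
    (forall y, E y -> v y = 0%R) -> upper_gradient v g ->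
    \int[mu]_(y in [set y | ball w T y /\ dE y < t]%R) (`|v y| `^ p)%:E <=
    (CS * t `^ p)%:E * \int[mu]_(y in [set y | dE y < tau * (2 * t)]%R) (g y `^ p)) ->
  forall (w : X) (T b : R) (K : nat) V G (delta := trunc_dist (T / 2 ^+ K) T),
    E w -> (0 < T)%R -> T%:E < (8^-1)%:E * diam [set: X] -> (0 < b <= 1)%R -> Lip V ->
    (forall y, E y -> V y = 0%R) -> upper_gradient V G ->
    (forall y, ~ ball w T y -> G y = 0) ->
    \int[mu]_(y in ball w T) (`|V y| `^ p * delta y `^ (- (p + b)))%:E <=
    (2 `^ (p + 1) * CS * (8 * tau / b))%:E *
      \int[mu]_(y in ball w T) ((delta y `^ (- b))%:E * G y `^ p).
Proof.
move=> CS0 strip w T b K V G delta Ew T0 Td b01 VLip VE ugV GO.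
have [mG G0 _] := ugV; have /andP[b0 b1] := b01.
have tau0 : (0 < tau)%R := lt_le_trans ltr01 tau1.
have E0 : E !=set0 by exists w.
pose e := (T / 2 ^+ K)%R.
have e0 : (0 < e)%R by rewrite divr_gt0// exprn_gt0.
have eT : (e <= T)%R.
  by rewrite ler_pdivrMr ?exprn_gt0// ler_peMr ?(ltW T0)// exprn_ege1// ler1n.
have deltaT y : (e <= delta y <= T)%R by apply: trunc_dist_itv; rewrite e0.
have delta0 y : (0 < delta y)%R by have /andP[/(lt_le_trans e0)] := deltaT y.
have wdE y : ball w T y -> (dE y < T)%R.
  by move=> /ballP wy; rewrite (le_lt_trans (dist_set_le y Ew))// metric_sym.
have deltaE y : ball w T y -> delta y = Num.max e (dE y).
  by move=> /wdE yT; rewrite /delta /trunc_dist /clamp min_r// ltW.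
pose t (k : nat) : R := (T / 2 ^+ k)%R.
have t0 k : (0 < t k)%R by rewrite divr_gt0// exprn_gt0.
have tT k : (t k <= T)%R.
  by rewrite ler_pdivrMr ?exprn_gt0// ler_peMr ?(ltW T0)// exprn_ege1// ler1n.
pose S k := [set y | ball w T y /\ dE y < t k]%R.
pose D k := [set y | dE y < tau * (2 * t k)]%R.
have bS k : borel_set (S k).
  apply: (@measurableI _ (g_sigma_algebraType (@open X))); first exact: ball_borel.
  exact: borel_dist_set_lt.
have bD k : borel_set (D k) by exact: borel_dist_set_lt.
pose q : R := (p + b)%R.
have q0 : (0 < q)%R by rewrite addr_gt0.
pose f y : \bar R := (`|V y| `^ p)%:E; pose h y : \bar R := G y `^ p.
have f0 y : 0 <= f y by rewrite lee_fin powR_ge0.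
have h0 y : 0 <= h y by exact: poweR_ge0.
have bf : borel_fun f by apply: borel_powR; exact: Lip_borel.
have bh : borel_fun h by exact: borel_poweR.
have res0 (k : X -> \bar R) (A : set X) y : (forall y, 0 <= k y) -> 0 <= (k \_ A) y.
  by move=> k0; rewrite patchE; case: ifP.
have mfS k : measurable_fun [set: X] (fun y => (t k `^ (- q))%:E * (f \_ (S k)) y).
  by apply: measurable_funeM; apply: borel_fun_measurable; exact: borel_restrict.
have mhD k : measurable_fun [set: X] (fun y => (CS * t k `^ (- b))%:E * (h \_ (D k)) y).
  by apply: measurable_funeM; apply: borel_fun_measurable; exact: borel_restrict.
have fS0 k y : 0 <= (t k `^ (- q))%:E * (f \_ (S k)) y.
  by rewrite mule_ge0 ?lee_fin ?powR_ge0// res0.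
have CStb k : (0 <= CS * t k `^ (- b))%R by rewrite mulr_ge0 ?powR_ge0// ltW.
have hD0 k y : 0 <= (CS * t k `^ (- b))%:E * (h \_ (D k)) y.
  by rewrite mule_ge0 ?lee_fin// res0.
have sums : \int[mu]_y (\sum_(0 <= k < K.+1) (t k `^ (- q))%:E * (f \_ (S k)) y) <=
    \int[mu]_y (\sum_(0 <= k < K.+1) (CS * t k `^ (- b))%:E * (h \_ (D k)) y).
  rewrite ge0_integral_sum//.
  rewrite ge0_integral_sum//.
  apply: lee_sum => k _.
  have rf0 y : 0 <= (f \_ (S k)) y by exact: res0.
  have rh0 y : 0 <= (h \_ (D k)) y by exact: res0.
  have mrf : measurable_fun [set: X] (f \_ (S k)).
    by apply: borel_fun_measurable; exact: borel_restrict.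
  have mrh : measurable_fun [set: X] (h \_ (D k)).
    by apply: borel_fun_measurable; exact: borel_restrict.
  rewrite ge0_integralZl_EFin ?powR_ge0// ge0_integralZl_EFin//.
  rewrite -!integral_mkcond.
  have := strip w T (t k) V G Ew (t0 k) (tT k) Td VLip VE ugV.
  move=> /(lee_wpmul2l (_ : 0 <= (t k `^ (- q))%:E)); rewrite lee_fin powR_ge0.
  move=> /(_ isT) /le_trans; apply; rewrite muleA -EFinM le_eqVlt.
  apply/orP; left; apply/eqP; congr (_%:E * _).
  rewrite mulrCA -powRD_pos//.
  by rewrite /q; congr (_ * _ `^ _)%R; ring.
have left_le : \int[mu]_(y in ball w T) (`|V y| `^ p * delta y `^ (- q))%:E <=
    (2 `^ (p + 1))%:E * \int[mu]_y (\sum_(0 <= k < K.+1) (t k `^ (- q))%:E * (f \_ (S k)) y).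
  rewrite -ge0_integralZl_EFin ?powR_ge0//; last 2 first.
  - by move=> y _; apply: sume_ge0 => k _; exact: fS0.
  - by apply: emeasurable_sum => k; exact: mfS.
  apply: le_integral_set => //.
  - by move=> y; rewrite lee_fin mulr_ge0// powR_ge0.
  - move=> y; rewrite mule_ge0 ?lee_fin ?powR_ge0//; apply: sume_ge0 => k _.
    exact: fS0.
  move=> y yB.
  (* Take the last scale t_k > dE y, or k = K if all of them are. *)
  have [k kK [yk tk]] : exists2 k, (k < K.+1)%N & (dE y < t k)%R /\ (t k <= 2 * delta y)%R.
    rewrite deltaE//; have H n : (exists2 k, (k < n.+1)%N & (dE y < t k)%R /\ (t k <= 2 * dE y)%R) \/ (dE y < t n)%R.
      elim: n => [|n [[k kn kP]|yn]].
      - by right; rewrite /t expr0 divr1 wdE.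
      - by left; exists k => //; exact: ltnW.
      - have [|yn1] := ltP (dE y) (t n.+1); first by right.
        left; exists n => //; split => //.
        have -> : t n = (2 * t n.+1)%R by rewrite /t exprS; field; rewrite expf_neq0.
        by rewrite ler_pM2l.
    have [[k kK [yk tk]]|yK] := H K.
      exists k => //; split => //; rewrite (le_trans tk)// ler_pM2l//.
      by rewrite le_max lexx orbT.
    exists K => //; split => //; rewrite (@le_trans _ _ (2 * e)%R)//.
      by rewrite mulr2n mulrDl mul1r lerDl ltW.
    by rewrite ler_pM2l// le_max lexx.
  have SE : (f \_ (S k)) y = f y by rewrite patchE mem_set.
  apply: (@le_trans _ _ ((2 `^ (p + 1))%:E * ((t k `^ (- q))%:E * f y))); last first.
    rewrite lee_wpmul2l ?lee_fin ?powR_ge0// -SE.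
    rewrite (big_rem k)/= ?mem_index_iota// leeDl//.
    by apply: sume_ge0 => j _; exact: fS0.
  rewrite -!EFinM lee_fin mulrC mulrA ler_wpM2r ?powR_ge0//.
  apply: (@le_trans _ _ (2 `^ (p + 1) * (2 * delta y) `^ (- q))%R); last first.
    by rewrite ler_wpM2l ?powR_ge0// ler_powRN// ltW.
  rewrite powRM ?(ltW (delta0 _))// mulrA ler_peMl ?powR_ge0//.
  rewrite -powRD_pos//.
  by rewrite -[leLHS](powRr0 2) ler_powR ?ler1n// /q; lra.
apply: le_trans left_le _; rewrite -(mulrA (2 `^ (p + 1))%R) (EFinM (2 `^ (p + 1))) -muleA.
rewrite lee_wpmul2l ?lee_fin ?powR_ge0//; apply: le_trans sums _.
have b80 : (0 <= CS * (8 * tau / b))%R.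
  by rewrite mulr_ge0 ?(ltW CS0)// divr_ge0 ?(ltW b0)// mulr_ge0 ?(ltW tau0).
have bdelta : borel_fun (fun y => (delta y `^ (- b))%:E).
  apply: borel_powR_pos; first exact: Lip_borel (Lip_trunc_dist _ _ E0).
  by move=> y; exact: ltW.
have dh0 y : 0 <= (delta y `^ (- b))%:E * h y.
  by rewrite mule_ge0 ?lee_fin ?powR_ge0.
have mdh : measurable_fun (ball w T) (fun y => (delta y `^ (- b))%:E * h y).
  apply: measurable_funS (@subsetT _ _) _ => //; apply: borel_fun_measurable.
  exact: emeasurable_funM.
rewrite -ge0_integralZl_EFin//; last exact: measurable_ballX.
apply: ge0_le_integral_sets.
- by move=> y; apply: sume_ge0 => k _; exact: hD0.
- by move=> y; rewrite mule_ge0.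
- move=> y _ yB.
  apply: (@le_trans _ _ (CS%:E * ((\sum_(0 <= k < K.+1) (if (dE y < tau * (2 * t k))%R then
    T `^ (- b) * (2 `^ b) ^+ k else 0)%R)%:E * h y))).
    rewrite -sumEFin ge0_sume_distrl; last first.
      move=> k _; rewrite lee_fin; case: ifP => // _.
      by rewrite mulr_ge0 ?exprn_ge0 ?powR_ge0.
    rewrite ge0_sume_distrr; last first.
      move=> k _; rewrite mule_ge0// lee_fin; case: ifP => // _.
      by rewrite mulr_ge0 ?exprn_ge0 ?powR_ge0.
    apply: lee_sum => k _; rewrite patchE.
    have -> : (y \in D k) = (dE y < tau * (2 * t k))%R.
      by apply/idP/idP; rewrite inE.
    case: (dE y < _)%R; last by rewrite mul0e !mule0.
    rewrite muleA -EFinM le_eqVlt; apply/orP; left; apply/eqP; congr ((_ * _)%:E * _).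
    rewrite /t powRM ?invr_ge0 ?exprn_ge0 ?(ltW T0)//; congr (_ * _)%R.
    by rewrite powRVN ?exprn_ge0// powR_exprn.
  rewrite (EFinM CS) -muleA lee_wpmul2l ?lee_fin ?(ltW CS0)//.
  rewrite muleA -EFinM lee_wpmul2r// lee_fin.
  have [th1 thb] := two_powR_ratio b01.
  apply: (@le_trans _ _ (2 `^ b / (2 `^ b - 1) * (2 * tau * delta y `^ (- b)))%R).
    apply: geometric_sum_le => //; rewrite ?mulr_ge0 ?powR_ge0 ?(ltW tau0)//.
    move=> k kK yk.
    apply: (@le_trans _ _ (t k `^ (- b))%R).
      rewrite /t powRM ?invr_ge0 ?exprn_ge0 ?(ltW T0)// ler_wpM2l ?powR_ge0//.
      by rewrite powRVN ?exprn_ge0// powR_exprn.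
    have ttau : (0 < tau * 2)%R by rewrite mulr_gt0.
    have dk : (delta y <= tau * 2 * t k)%R.
      rewrite deltaE// ge_max -mulrA (ltW yk) andbT.
      apply: (@le_trans _ _ (t k)).
        rewrite /e /t ler_pM2l// lef_pV2 ?posrE ?exprn_gt0//.
        by rewrite ler_eXn2l ?ltr1n.
      have tau2 : (1 <= tau * 2)%R by move: tau1; lra.
      by rewrite mulrA -{1}[t k]mul1r ler_wpM2r// ltW.
    have tk : (t k = (tau * 2) ^-1 * (tau * 2 * t k))%R.
      by rewrite mulrA mulVf ?mul1r// gt_eqF.
    rewrite tk powRM ?invr_ge0 ?(ltW ttau) ?mulr_ge0 ?(ltW tau0) ?(ltW (t0 k))//.
    apply: ler_pM; rewrite ?powR_ge0//; last by rewrite ler_powRN// ltW.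
    rewrite powRVN ?(ltW ttau)//.
    rewrite mulrC -[leRHS]powRr1 ?mulr_ge0 ?(ltW tau0)// ler_powR//.
    by move: tau1; lra.
    exact: ltW.
  rewrite mulrA ler_wpM2r ?powR_ge0//.
  have -> : (8 * tau / b = 4 / b * (2 * tau))%R by field; rewrite gt_eqF.
  by rewrite ler_wpM2r// mulr_ge0// ltW.
- move=> y _ yB; apply: big1 => k _; rewrite patchE /h GO// poweR0r ?gt_eqF//.
  by case: ifP; rewrite mule0.
Qed.

(** * Absorption *)

Lemma small_powR (A q : R) : (0 < A)%R -> (0 < q)%R ->
  exists2 b : R, (0 < b <= 1)%R & (A * b `^ q <= 2^-1)%R.
Proof.
move=> A0 q0; pose s : R := ((2 * A)^-1 `^ q^-1)%R.
have A20 : (0 < (2 * A)^-1)%R by rewrite invr_gt0 mulr_gt0.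
have s0 : (0 < s)%R by rewrite powR_gt0.
exists (Num.min 1 s)%R; first by rewrite lt_min ltr01 s0 ge_min lexx.
have : (Num.min 1 s `^ q <= s `^ q)%R.
  apply: ge0_ler_powR; rewrite ?nnegrE ?(ltW q0) ?(ltW s0)//.
    by rewrite le_min ler01 ltW.
  by rewrite ge_min lexx orbT.
rewrite /s -powRrM mulVf ?gt_eqF// powRr1 ?(ltW A20)// => bs.
rewrite (@le_trans _ _ (A * (2 * A)^-1)%R) ?ler_wpM2l ?(ltW A0)//.
by rewrite invfM mulrCA mulfV ?mulr1// gt_eqF.
Qed.

(** The truncated distance is 1-Lipschitz and at least [e]. Hence between points at
    distance at most [e] it varies by a bounded factor, and so do its powers, as
    [upper_gradientM] requires. *)
Lemma weight_product (e T a M : R) v g (delta := trunc_dist e T) : E !=set0 ->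
  (0 < e <= T)%R -> (0 <= a <= 1)%R -> Lip v -> (forall y, `|v y| <= M)%R ->
  upper_gradient v g ->
  Lip (fun y => v y * delta y `^ a)%R /\
  upper_gradient (fun y => v y * delta y `^ a)%R
    (fun y => (3 * (2 * delta y `^ a))%:E * g y +
              (9 * a * delta y `^ (a - 1) * `|v y|)%:E).
Proof.
move=> E0 eT /andP[a0 a1] vLip vM ugv; have /andP[e0 eT'] := eT.
have deltaT y : (e <= delta y <= T)%R by exact: trunc_dist_itv.
have delta_ge y : (e <= delta y)%R by have /andP[] := deltaT y.
have delta0 y : (0 < delta y)%R by exact: lt_le_trans e0 (delta_ge y).
have delta_le y z : (delta y <= delta z + mdist y z)%R.
  have := trunc_dist_lip e T y z E0; rewrite -/delta.
  by move=> /(le_trans (ler_norm _)); rewrite lerBlDl addrC.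
have bdelta : borel_fun (EFin \o delta) by exact: Lip_borel (Lip_trunc_dist _ _ E0).
have k1a (k t : R) : (1 <= k)%R -> (0 <= t)%R -> ((k * t) `^ a <= k * t `^ a)%R.
  move=> k1 t0; have k0 := le_trans ler01 k1.
  by rewrite powRM// ler_wpM2r ?powR_ge0// -[leRHS]powRr1// ler_powR.
split.
  apply: LipM vLip _ vM (_ : forall y, `|delta y `^ a| <= T `^ a)%R; last first.
    move=> y; rewrite ger0_norm ?powR_ge0// ge0_ler_powR ?nnegrE ?(ltW (delta0 y))//.
      by rewrite (le_trans (ltW e0)).
    by have /andP[] := deltaT y.
  exists (a * (T `^ a / e))%R => y z; apply: le_trans (powR_diff_le a0 e0 _ _) _ => //.
  rewrite ler_wpM2l ?mulr_ge0 ?invr_ge0 ?powR_ge0 ?(ltW e0)//.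
  exact: trunc_dist_lip.
apply: (upper_gradientM (e := e) (a := (fun y => 2 * delta y `^ a)%R)
    (b := (fun y => 9 * a * delta y `^ (a - 1))%R)) ugv.
- exact: e0.
- exact: Lip_borel.
- suff : borel_fun (fun y => 2%:E * (delta y `^ a)%:E) by [].
  by apply: measurable_funeM; apply: borel_powR_pos => // y; exact: ltW.
- suff : borel_fun (fun y => (9 * a)%:E * (delta y `^ (a - 1))%:E) by [].
  by apply: measurable_funeM; apply: borel_powR_pos => // y; exact: ltW.
- by move=> y; rewrite mulr_ge0// powR_ge0.
- by move=> y; rewrite !mulr_ge0// powR_ge0.
- move=> y z yz; rewrite ger0_norm ?powR_ge0//.
  apply: le_trans (k1a _ _ (ler1n _ 2) (ltW (delta0 z))).
  rewrite ge0_ler_powR ?nnegrE ?mulr_ge0 ?(ltW (delta0 _))//.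
  have := delta_le y z; have := delta_ge z; lra.
- move=> y z z' yz yz'.
  have zz' : (mdist z z' <= 2 * e)%R.
    have := metric_triangle z y z'; rewrite (metric_sym z y); lra.
  have d0 := delta0 z'.
  have m0 : (0 < delta z' / 3)%R by rewrite divr_gt0.
  (* delta changes by at most 2 e and is at least e, hence changes at most by the
     factor 3; the constant 9 is the quotient of the two ends of this range. *)
  have yI : (delta z' / 3 <= delta y <= 3 * delta z')%R.
    have := delta_le y z'; have := delta_le z' y; rewrite (metric_sym z' y).
    have := delta_ge y; have := delta_ge z'.
    by move=> *; apply/andP; split; lra.
  have zI : (delta z' / 3 <= delta z <= 3 * delta z')%R.
    have := delta_le z z'; have := delta_le z' z; rewrite (metric_sym z' z).
    have := delta_ge z; have := delta_ge z'.
    by move=> *; apply/andP; split; lra.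
  apply: le_trans (powR_diff_le a0 m0 yI zI) _.
  apply: ler_pM => //; first by rewrite mulr_ge0// divr_ge0 ?powR_ge0// ltW.
    rewrite powRD_pos// powRN powRr1 ?(ltW d0)//.
    have := k1a _ _ (ler1n R 3) (ltW d0) => H.
    have -> : (9 * a * (delta z' `^ a / delta z') =
      a * (3 * delta z' `^ a / (delta z' / 3)))%R by field; rewrite gt_eqF.
    by rewrite ler_wpM2l// ler_wpM2r// invr_ge0 ltW.
  exact: trunc_dist_lip.
Qed.

(** Wannebo's absorption argument: [weighted_hardy] is used for v delta^(b / p).
    Differentiating the weight produces the factor (b / p)^p, which beats the
    constant C / b of [weighted_hardy] for small b because p > 1. The truncation
    makes the absorbed integral finite. *)
Lemma truncated_hardy : exists2 C : R, (0 < C)%R &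
  forall (w : X) (T : R) (K : nat) v g (delta := trunc_dist (T / 2 ^+ K) T),
    E w -> (0 < T)%R -> T%:E < (8^-1)%:E * diam [set: X] -> Lip v ->
    (forall y, E y -> v y = 0%R) -> (forall y, ~ ball w T y -> v y = 0%R) ->
    upper_gradient v g ->
    \int[mu]_(y in ball w T) (`|v y| `^ p * delta y `^ (- p))%:E <=
    C%:E * \int[mu]_(y in ball w T) (g y `^ p).
Proof.
have [CS CS0 strip] := strip_estimate.
have tau0 : (0 < tau)%R := lt_le_trans ltr01 tau1.
pose A : R := (2 `^ (p + 1) * CS * (8 * tau))%R.
have A0 : (0 < A)%R by rewrite !mulr_gt0// powR_gt0.
have A'0 : (0 < A * (2 `^ p * 9 `^ p))%R by rewrite !mulr_gt0// powR_gt0.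
have p10 : (0 < p - 1)%R by rewrite subr_gt0.
have [b b01 Ab] := small_powR A'0 p10; have /andP[b0 b1] := b01.
have Cb0 : (0 < A / b * (2 `^ p * 6 `^ p))%R by rewrite mulr_gt0 ?divr_gt0// mulr_gt0 ?powR_gt0.
exists (2 * (A / b * (2 `^ p * 6 `^ p)))%R; first by rewrite mulr_gt0.
move=> w T K v g delta Ew T0 Td vLip vE vT ugv; have [mg g0 _] := ugv.
have E0 : E !=set0 by exists w.
pose e := (T / 2 ^+ K)%R.
have e0 : (0 < e)%R by rewrite divr_gt0// exprn_gt0.
have eT : (e <= T)%R.
  by rewrite ler_pdivrMr ?exprn_gt0// ler_peMr ?(ltW T0)// exprn_ege1// ler1n.
have deltaT y : (e <= delta y <= T)%R by apply: trunc_dist_itv; rewrite e0.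
have delta0 y : (0 < delta y)%R by have /andP[/(lt_le_trans e0)] := deltaT y.
have [M M0 vM'] := Lip_ball_bounded w T vLip.
have vM y : (`|v y| <= M)%R.
  by have [/vM'//|/vT ->] := pselect (ball w T y); rewrite normr0.
have [a aE ap] : exists2 a, (a = b / p)%R & (a * p = b)%R.
  by exists (b / p)%R => //; rewrite divfK// gt_eqF.
have a01 : (0 <= a <= 1)%R.
  by rewrite aE divr_ge0 ?(ltW b0) ?(ltW p0)//= ler_pdivrMr// mul1r (le_trans b1)// ltW.
have /andP[a0 a1] := a01.
have eT0 : (0 < e <= T)%R by rewrite e0.
have [VLip ugV] := weight_product E0 eT0 a01 vLip vM ugv.
set V := (fun y => v y * _)%R in VLip ugV.
set G := (fun y => _ + _) in ugV.
have VE y : E y -> V y = 0%R by rewrite /V => /vE ->; rewrite mul0r.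
pose G' := G \_ [set y | V y != 0%R].
have ugV' : upper_gradient V G' by exact: upper_gradient_restrict.
have G'0 y : ~ ball w T y -> G' y = 0.
  move=> /vT vy0; rewrite /G' patchE ifF//; apply/negbTE/negP; rewrite inE/=.
  by rewrite /V vy0 mul0r eqxx.
have [_ G0 _] := ugV.
have G'G y : G' y <= G y by rewrite /G' patchE; case: ifP.
have G'ge0 y : 0 <= G' y by have [_ + _] := ugV'; apply.
have := weighted_hardy CS0 strip K Ew T0 Td b01 VLip VE ugV' G'0.
rewrite -/delta.
under eq_integral => y _.
  have -> : (`|V y| `^ p * delta y `^ (- (p + b)) = `|v y| `^ p * delta y `^ (- p))%R.
    rewrite /V normrM (ger0_norm (powR_ge0 _ _)) powRM ?powR_ge0// -powRrM -/delta ap.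
    by rewrite -mulrA -powRD_pos//; congr (_ * _ `^ _)%R; ring.
  over.
have -> : (2 `^ (p + 1) * CS * (8 * tau / b) = A / b)%R by rewrite /A; ring.
pose h y : \bar R := (`|v y| `^ p * delta y `^ (- p))%:E.
pose F := \int[mu]_(y in ball w T) h y; pose I := \int[mu]_(y in ball w T) (g y `^ p).
rewrite -/F => FG; rewrite -/F -/I.
have h0 y : 0 <= h y by rewrite lee_fin mulr_ge0 ?powR_ge0.
have gp0 y : 0 <= g y `^ p by exact: poweR_ge0.
have bdelta : borel_fun (EFin \o delta) by exact: Lip_borel (Lip_trunc_dist _ _ E0).
have bh : borel_fun h.
  suff : borel_fun (fun y => (`|v y| `^ p)%:E * (delta y `^ (- p))%:E) by [].
  apply: emeasurable_funM.
    by apply: borel_powR; exact: Lip_borel.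
  by apply: borel_powR_pos => // y; exact: ltW.
have bgp := borel_poweR p mg.
have mB : measurable (ball w T) by exact: measurable_ballX.
have bm k : borel_fun k -> measurable_fun (ball w T) k.
  by move=> /borel_fun_measurable mk; exact: measurable_funS mk.
have I0 : 0 <= I by exact: integral_ge0.
have F0 : 0 <= F by apply: integral_ge0 => y _; exact: h0.
(* The integrand is bounded, because delta is at least e. *)
have Ffin : F < +oo.
  apply: (@le_lt_trans _ _ ((M `^ p * e `^ (- p)) * ball_mass w T)%:E); last exact: ltry.
  rewrite -(integral_const_ball w (M `^ p * e `^ (- p)) T0); apply: le_integral_set => //.
    by move=> y; rewrite lee_fin mulr_ge0 ?powR_ge0.
  move=> y _; rewrite lee_fin ler_pM ?powR_ge0//.
    by rewrite ge0_ler_powR ?nnegrE ?(ltW p0).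
  by rewrite ler_powRN ?(ltW p0)//; have /andP[] := deltaT y.
have key : \int[mu]_(y in ball w T) ((delta y `^ (- b))%:E * G' y `^ p) <=
    (2 `^ p)%:E * ((6 `^ p)%:E * I + (9 `^ p * b `^ p)%:E * F).
  have k1 y : 0 <= (6 `^ p)%:E * g y `^ p by rewrite mule_ge0 ?lee_fin ?powR_ge0.
  have k2 y : 0 <= (9 `^ p * b `^ p)%:E * h y.
    by rewrite mule_ge0// lee_fin mulr_ge0 ?powR_ge0.
  have mk1 : measurable_fun (ball w T) (fun y => (6 `^ p)%:E * g y `^ p).
    by apply: measurable_funeM; exact: bm.
  have mk2 : measurable_fun (ball w T) (fun y => (9 `^ p * b `^ p)%:E * h y).
    by apply: measurable_funeM; exact: bm.
  have -> : (6 `^ p)%:E * I = \int[mu]_(y in ball w T) ((6 `^ p)%:E * g y `^ p).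
    by rewrite ge0_integralZl_EFin ?powR_ge0//; exact: bm.
  have -> : (9 `^ p * b `^ p)%:E * F = \int[mu]_(y in ball w T) ((9 `^ p * b `^ p)%:E * h y).
    by rewrite ge0_integralZl_EFin ?mulr_ge0 ?powR_ge0//; exact: bm.
  rewrite -ge0_integralD// -ge0_integralZl_EFin ?powR_ge0//; last 2 first.
  - by move=> y _; rewrite adde_ge0.
  - exact: emeasurable_funD.
  apply: le_integral_set => //.
  - by move=> y; rewrite mule_ge0 ?poweR_ge0 ?lee_fin ?powR_ge0.
  - by move=> y; apply: mule_ge0; [rewrite lee_fin powR_ge0|exact: adde_ge0].
  move=> y _; have d0 := delta0 y.
  have da0 : (0 <= delta y `^ a)%R by exact: powR_ge0.
  have c1 : (0 <= 3 * (2 * delta y `^ a))%R by rewrite !mulr_ge0.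
  have c2 : (0 <= 9 * a * delta y `^ (a - 1))%R by rewrite !mulr_ge0 ?powR_ge0.
  apply: (@le_trans _ _ ((delta y `^ (- b))%:E * ((2 `^ p)%:E *
      (((3 * (2 * delta y `^ a)) `^ p)%:E * g y `^ p +
       ((9 * a * delta y `^ (a - 1) * `|v y|) `^ p)%:E)))).
    rewrite lee_wpmul2l ?lee_fin ?powR_ge0//.
    apply: le_trans (le_poweR (ltW p0) (G'ge0 y) (G'G y)) _.
    rewrite -(poweR_EFinM _ c1 (g0 y)) -poweR_EFin; apply: poweRD_le; first exact: ltW.
      by rewrite mule_ge0.
    by rewrite lee_fin mulr_ge0.
  rewrite muleCA lee_wpmul2l ?lee_fin ?powR_ge0// ge0_muleDr; last 2 first.
  - by rewrite mule_ge0// lee_fin powR_ge0.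
  - by rewrite lee_fin powR_ge0.
  have dbb : (delta y `^ (- b) * delta y `^ b = 1)%R.
    by rewrite -powRD_pos// addNr powRr0.
  apply: leeD.
    rewrite muleA -EFinM lee_wpmul2r// lee_fin mulrA powRM// -powRrM ap.
    by rewrite mulrCA dbb mulr1 -[(3 * 2)%R]natrM.
  rewrite -!EFinM lee_fin powRM// powRM ?mulr_ge0 ?powR_ge0// powRM//.
  have -> : ((delta y `^ (a - 1)) `^ p = delta y `^ b * delta y `^ (- p))%R.
    by rewrite -powRrM mulrBl ap mul1r powRD_pos.
  rewrite [leLHS](_ : _ = delta y `^ (- b) * delta y `^ b *
    (9 `^ p * a `^ p * (`|v y| `^ p * delta y `^ (- p))))%R; last by ring.
  rewrite dbb mul1r ler_wpM2r ?mulr_ge0 ?powR_ge0// ler_wpM2l ?powR_ge0//.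
  rewrite ge0_ler_powR ?nnegrE ?(ltW b0) ?(ltW p0)//.
  by rewrite aE ler_pdivrMr// ler_peMr ?(ltW b0)// ltW.
have {FG key} := le_trans FG (lee_wpmul2l _ key).
rewrite lee_fin divr_ge0 ?(ltW A0) ?(ltW b0)// => /(_ isT).
have Ffn : F \is a fin_num by rewrite ge0_fin_numE.
rewrite -(fineK Ffn).
have : 0 <= I := I0; case: (I) => [i| |]//; last first.
  by move=> _ _; rewrite gt0_muley ?leey// lte_fin; exact: mulr_gt0.
rewrite lee_fin => i0 FG.
have {FG} : (fine F <= A / b * (2 `^ p * (6 `^ p * i + 9 `^ p * b `^ p * fine F)))%R.
  by rewrite -lee_fin.
rewrite -EFinM lee_fin.
have -> : (A / b * (2 `^ p * (6 `^ p * i + 9 `^ p * b `^ p * fine F)) =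
  A / b * (2 `^ p * 6 `^ p) * i + A * (2 `^ p * 9 `^ p) * (b `^ p / b) * fine F)%R.
  by ring.
have -> : (b `^ p / b = b `^ (p - 1))%R.
  by rewrite powRD_pos// powRN powRr1// ltW.
have f0 : (0 <= fine F)%R by exact: fine_ge0.
have := ler_wpM2r f0 Ab; lra.
Qed.

(** * The Hardy inequality *)

(** The constant of [truncated_hardy] does not depend on K, and the truncated
    distance is the distance where the latter is at least T / 2^K. *)
Lemma hardy_supported : exists2 C : R, (0 < C)%R &
  forall (w : X) (T : R) v g,
    E w -> (0 < T)%R -> T%:E < (8^-1)%:E * diam [set: X] -> Lip v ->
    (forall y, E y -> v y = 0%R) -> (forall y, ~ ball w T y -> v y = 0%R) ->
    upper_gradient v g ->
    \int[mu]_(y in ball w T `\` E) (`|v y| `^ p * dE y `^ (- p))%:E <=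
    C%:E * \int[mu]_(y in ball w T) (g y `^ p).
Proof.
have [C C0 truncated] := truncated_hardy; exists C => // w T v g Ew T0 Td vLip vE vT ugv.
have E0 : E !=set0 by exists w.
pose f y : \bar R := (`|v y| `^ p * dE y `^ (- p))%:E.
have f0 y : 0 <= f y by rewrite lee_fin mulr_ge0 ?powR_ge0.
have bf : borel_fun f.
  suff : borel_fun (fun y => (`|v y| `^ p)%:E * (dE y `^ (- p))%:E) by [].
  apply: emeasurable_funM.
    by apply: borel_powR; exact: Lip_borel.
  apply: borel_powR_pos; first exact: Lip_borel (Lip_dist_set E0).
  by move=> y; exact: dist_set_ge0.
pose A K := ball w T `\` [set y | dE y < T / 2 ^+ K]%R.
have mA K : measurable (A K).
  apply: measurableD; first exact: measurable_ballX.
  exact: borel_measurable (borel_dist_set_lt E0 _).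
have AP K y : A K y -> (T / 2 ^+ K <= dE y)%R.
  by move=> [_ /= /negP]; rewrite -leNgt.
have nA : nondecreasing_seq A.
  apply/nondecreasing_seqP => K; apply/subsetPset => y Ay; have [yB _] := Ay.
  split => //=; apply/negP; rewrite -leNgt; apply: le_trans (AP _ _ Ay).
  by rewrite ler_pM2l// lef_pV2 ?posrE ?exprn_gt0// ler_eXn2l// ltr1n.
have cvA : \int[mu]_(y in A K) f y @[K --> \oo] --> \int[mu]_(y in \bigcup_K A K) f y.
  apply: ge0_nondecreasing_set_cvg_integral => // K.
  exact: measurable_funS (borel_fun_measurable bf).
apply: (@le_trans _ _ (\int[mu]_(y in \bigcup_K A K) f y)).
  apply: le_integral_set => // y [yB nEy].
  have y0 : (0 < dE y)%R.
    rewrite lt_neqAle dist_set_ge0// andbT; apply/eqP => /esym /(dist_set0 E0 E_closed).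
    exact: nEy.
  have [K TK] := exp2_ge (T / dE y); exists K => //; split => //=.
  apply/negP; rewrite -leNgt ler_pdivrMr ?exprn_gt0// mulrC -ler_pdivrMr//.
rewrite -(cvg_lim _ cvA)//; apply: lime_le; first exact: cvgP cvA.
apply: nearW => K; apply: le_trans (truncated w T K v g Ew T0 Td vLip vE vT ugv).
apply: le_integral_set => // [y|y [yB _]|y Ay].
- by rewrite lee_fin mulr_ge0 ?powR_ge0.
- exact: yB.
have [yB _] := Ay; rewrite /f /trunc_dist /clamp min_r ?max_r//; first exact: AP.
by move/ballP : yB => wy; rewrite (le_trans (dist_set_le y Ew))// metric_sym ltW.
Qed.

(** The cutoff function between B(w, r) and B(w, 2 r) adds the term |u| / r to the
    upper gradient, which [boundaryE] controls because [w] is in [E]. *)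
Lemma local_hardy : exists2 C : R, (0 < C)%R &
  forall (w : X) (r : R) u g,
    E w -> (0 < r)%R -> (2 * r)%:E < (8^-1)%:E * diam [set: X] -> Lip u ->
    (forall y, E y -> u y = 0%R) -> upper_gradient u g ->
    \int[mu]_(y in ball w r `\` E) (`|u y| `^ p * dE y `^ (- p))%:E <=
    C%:E * \int[mu]_(y in ball w (tau * (2 * r))) (g y `^ p).
Proof.
have [C C0 hardy] := hardy_supported.
have P0 : (0 < 2 `^ p :> R)%R by rewrite powR_gt0.
have C30 : (0 < 3 `^ p + CB)%R by rewrite addr_gt0// powR_gt0.
exists (C * (2 `^ p * (3 `^ p + CB)))%R; first by rewrite !mulr_gt0.
move=> w r u g Ew r0 rd uLip uE ugu; have [mg g0 _] := ugu.
have r20 : (0 < 2 * r)%R by rewrite mulr_gt0.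
have rp0 : (0 < r `^ p)%R by rewrite powR_gt0.
pose psi := bump w 2 r.
pose v y : R := (u y * psi y)%R.
have psi0 y : ~ ball w (2 * r) y -> psi y = 0%R.
  by move=> wy; rewrite /psi bump_eq0// leNgt; apply/negP => xy; apply/wy/ballP.
have vE y : E y -> v y = 0%R by move=> Ey; rewrite /v uE// mul0r.
have vT y : ~ ball w (2 * r) y -> v y = 0%R by move=> wy; rewrite /v psi0// mulr0.
have vLip : Lip v.
  have [M M0 uM] := Lip_ball_bounded w (2 * r) uLip.
  (* u need not be bounded, but only its values on the ball matter. *)
  have -> : v = (fun y => clamp (- M) M (u y) * psi y)%R.
    apply/funext => y; rewrite /v; have [yB|/psi0 ->] := pselect (ball w (2 * r) y).
      by rewrite clamp_id// -ler_norml uM.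
    by rewrite !mulr0.
  have clampM y : (`|clamp (- M) M (u y)| <= M)%R.
    by rewrite ler_norml clamp_itv// ge0_cp.
  apply: LipM _ (Lip_bump w 2 r0) clampM (@norm_bump w 2 r).
  apply: (Lip_comp ler01) uLip => s t; rewrite mul1r; exact: clamp_lip.
pose G y : \bar R := (3 * 1)%:E * g y + (r^-1 * `|u y|)%:E.
have ugv : upper_gradient v G.
  apply: (upper_gradientM (e := 1%R)) ugu => //.
  - exact: Lip_borel.
  - exact: measurable_cst.
  - exact: measurable_cst.
  - by move=> y; rewrite invr_ge0 ltW.
  - by move=> y z _; exact: norm_bump.
  - by move=> y z z' _ _; exact: bump_lip.
have rd8 : r%:E < (8^-1)%:E * diam [set: X].
  by apply: le_lt_trans rd; rewrite lee_fin ler_peMl ?(ltW r0)// ler1n.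
have := boundaryE Ew r0 rd8 uLip uE ugu.
set A := \int[mu]_(y in _) _; set J := \int[mu]_(y in ball w (tau * _)) _ => AJ.
have J0 : 0 <= J by apply: integral_ge0 => y _; exact: poweR_ge0.
set Om := ball w (2 * r) in A AJ *.
have GJ : \int[mu]_(y in Om) (G y `^ p) <= (2 `^ p * (3 `^ p + CB))%:E * J.
  have kg0 y : 0 <= (3 `^ p)%:E * g y `^ p.
    by rewrite mule_ge0 ?lee_fin ?powR_ge0 ?poweR_ge0.
  have kv0 y : 0 <= (r `^ p)^-1%:E * (`|u y| `^ p)%:E.
    by rewrite mule_ge0 ?lee_fin ?invr_ge0 ?powR_ge0.
  have mOm : measurable Om by exact: measurable_ballX.
  have bm k : borel_fun k -> measurable_fun Om k.
    by move=> /borel_fun_measurable mk; exact: measurable_funS mk.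
  have mgp := bm _ (borel_poweR p mg).
  have mup := bm _ (borel_powR p (Lip_borel uLip)).
  apply: (@le_trans _ _ (\int[mu]_(y in Om) ((2 `^ p)%:E * ((3 `^ p)%:E * g y `^ p +
      (r `^ p)^-1%:E * (`|u y| `^ p)%:E)))).
    apply: le_integral_set => //.
    - by move=> y; exact: poweR_ge0.
    - by move=> y; apply: mule_ge0; [rewrite lee_fin ltW|exact: adde_ge0].
    - move=> y _; rewrite /G mulr1.
      apply: le_trans (poweRD_le _ _ _) _; rewrite ?(ltW p0)//.
      + by rewrite mule_ge0.
      + by rewrite lee_fin mulr_ge0// invr_ge0 ltW.
      rewrite lee_wpmul2l ?lee_fin ?(ltW P0)// poweR_EFinM// poweR_EFin leeD2l//.
      rewrite -EFinM lee_fin powRM ?invr_ge0 ?(ltW r0)// -powR_inv1 ?(ltW r0)//.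
      by rewrite -powRrM mulN1r powRN.
  have mk1 : measurable_fun Om (fun y => (3 `^ p)%:E * g y `^ p) by exact: measurable_funeM.
  have mk2 : measurable_fun Om (fun y => (r `^ p)^-1%:E * (`|u y| `^ p)%:E).
    exact: measurable_funeM.
  rewrite ge0_integralZl_EFin ?powR_ge0//; last 2 first.
  - by move=> y _; rewrite adde_ge0.
  - exact: emeasurable_funD.
  rewrite ge0_integralD//.
  rewrite ge0_integralZl_EFin ?powR_ge0//; last by move=> y _; exact: poweR_ge0.
  rewrite ge0_integralZl_EFin ?invr_ge0 ?powR_ge0//.
  rewrite -/A (EFinM (2 `^ p)) -muleA lee_wpmul2l ?lee_fin ?(ltW P0)//.
  rewrite EFinD ge0_muleDl ?lee_fin ?powR_ge0 ?(ltW CB0)//; apply: leeD.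
    rewrite lee_wpmul2l ?lee_fin ?powR_ge0//; apply: le_integral_set => //.
    + by move=> y; exact: poweR_ge0.
    + by move=> y; exact: poweR_ge0.
    + by apply: sub_ball_same; rewrite ler_peMl// ltW.
  apply: le_trans (lee_wpmul2l _ AJ) _; first by rewrite lee_fin invr_ge0 ltW.
  rewrite muleA -EFinM lee_wpmul2r// lee_fin le_eqVlt; apply/orP; left; apply/eqP.
  by field; rewrite gt_eqF.
apply: (@le_trans _ _ (\int[mu]_(y in Om `\` E) (`|v y| `^ p * dE y `^ (- p))%:E)).
  apply: le_integral_set => //.
  - by move=> y; rewrite lee_fin mulr_ge0 ?powR_ge0.
  - by move=> y; rewrite lee_fin mulr_ge0 ?powR_ge0.
  - move=> y [yB nEy]; split => //; apply: sub_ball_same yB.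
    by rewrite ler_peMl ?(ltW r0)// ler1n.
  - move=> y [/ballP yB _]; rewrite /v /psi bump_eq1 ?mulr1//.
    by rewrite (_ : (2 - 1) * r = r)%R; [exact: ltW|ring].
apply: le_trans (hardy w (2 * r)%R v G Ew r20 rd vLip vE vT ugv) _.
by rewrite (EFinM C) -muleA lee_wpmul2l// lee_fin ltW.
Qed.

End hardy.
End poincare_consequences.
End metric_measure_space.

Theorem theorem1p3 (R : realType) (d : measure_display)
    (X : measurableMetricType d R) (mu : {measure set X -> \bar R})
    (p tau : R) (E : set X)
    (mu_borel : borel_regular_complete mu)
    (mu_balls : finite_positive_on_balls mu)
    (mu_doubling : doubling mu)
    (p_gt1 : (1 < p)%R)
    (tau_ge1 : (1 <= tau)%R)
    (poincare1p : poincare mu 1%R p tau)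
    (poincarepp : poincare mu p p tau)
    (E_closed : closed E)
    (E_fat : uniformly_fat mu p E) :
  exists C : R, (0 < C)%R /\
    forall (u : X -> R) (g : X -> \bar R) (w : X) (r : R),
      Lip u -> (forall x, E x -> u x = 0%R) ->
      weak_upper_gradient mu p (EFin \o u) g ->
      E w -> (0 < r)%R -> r%:E < (32^-1)%:E * diam [set: X] ->
      \int[mu]_(x in ball w r `\` E) ((`|u x|%:E / edist_inf E x) `^ p)
      <= C%:E * \int[mu]_(x in ball w (32 * tau ^+ 2 * r)%R) (g x `^ p).
Proof.
have p0 : (0 < p)%R := lt_trans ltr01 p_gt1.
have tau0 : (0 < tau)%R := lt_le_trans ltr01 tau_ge1.
have [CD [CD1 doublingE]] := mu_doubling.
have [CP CP0 poincareE] := poincare_Lip mu_borel mu_balls p_gt1 tau_ge1 poincarepp.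
have [c0 [/andP[c00 _] fat]] := E_fat.
have [CB CB0 boundaryE] := boundary_poincare mu_borel mu_balls p_gt1 tau_ge1 CD1
  doublingE CP0 poincareE c00 fat.
have [C C0 hardy] := local_hardy mu_borel mu_balls p_gt1 tau_ge1 CD1 doublingE
  E_closed CB0 boundaryE.
have P0 : (0 < 2 `^ p :> R)%R by rewrite powR_gt0.
exists (C * 2 `^ p)%R; split; first by rewrite mulr_gt0.
move=> u g w r uLip uE ug Ew r0 rd; have E0 : E !=set0 by exists w.
have r2d : (2 * r)%:E < (8^-1)%:E * diam [set: X].
  apply: (@le_lt_trans _ _ (4 * r)%:E); first by rewrite lee_fin ler_wpM2r ?ler_nat// ltW.
  have -> : (8^-1 = 4 * 32^-1 :> R)%R by field.
  by rewrite !EFinM -muleA lte_pmul2l.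
apply/lee_addgt0Pr => e e0; have eC0 : (0 < e / C)%R by rewrite divr_gt0.
have [g' ug' g'g] := weak_upper_gradient_strong mu_borel mu_balls p0 ug eC0.
apply: (@le_trans _ _ (\int[mu]_(y in ball w r `\` E)
    (`|u y| `^ p * dist_set E y `^ (- p))%:E)).
  apply: le_integral_set => // [y|y|y [_ nEy]].
  - exact: poweR_ge0.
  - by rewrite lee_fin mulr_ge0 ?powR_ge0.
  have y0 : (0 < dist_set E y)%R.
    rewrite lt_neqAle dist_set_ge0// andbT; apply/eqP => /esym /(dist_set0 E0 E_closed).
    exact: nEy.
  rewrite edist_inf_dist_set// inver gt_eqF// -EFinM poweR_EFin lee_fin.
  rewrite powRM ?invr_ge0 ?(ltW y0)// ler_wpM2l ?powR_ge0//.
  by rewrite -(powRVN _ (ltW y0)) opprK.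
apply: le_trans (hardy w r u g' Ew r0 r2d uLip uE ug') _.
apply: le_trans (lee_wpmul2l _ (g'g _ (measurable_ballX mu_borel _ _))) _.
  by rewrite lee_fin ltW.
rewrite ge0_muleDr ?lee_fin ?(ltW eC0)//; last first.
  by rewrite mule_ge0 ?lee_fin ?(ltW P0)// integral_ge0// => y _; exact: poweR_ge0.
have -> : C%:E * (e / C)%:E = e%:E by rewrite -EFinM mulrC divfK// gt_eqF.
rewrite muleA leeD2r// EFinM lee_wpmul2l//.
  by rewrite lee_fin mulr_ge0// ltW.
apply: le_integral_set => //; try by move=> y; exact: poweR_ge0.
apply: sub_ball_same; rewrite mulrA ler_wpM2r ?(ltW r0)//.
rewrite expr2 mulrCA ler_wpM2l ?(ltW tau0)//; lra.
Qed.
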